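(* Let $f_-$ and $f_+$ be two strictly convex flux functions with respective sonic points $u^\star_-$ and $u^\star_+$ (finite or not), and let $u$ be a CRD solution with Riemann data $(u_L,u_R)$ that belongs to the class of double-waved functions, i.e. that consists of a (non trivial) left-wave in the half-space $\{\xi<0\}$, followed by a constant state $\bar u$ across the interface $\xi=0$, and a (non trivial) right-wave in the half-space $\{\xi>0\}$. Then $\bar u\in(u^\star_+,u^\star_-)$ and the intermediate state $\bar u$ is uniquely determined by the selection criterion $$\min_{-M\le\xi\le0}h(\xi;u)=\min_{0\le\xi\le M}h(\xi;u),$$ that is, $\bar u$ is the only value in $(u^\star_+,u^\star_-)$ which is the intermediate state of a double-waved function with data $(u_L,u_R)$ satisfying this criterion.
   Context: Standing assumption: $f_-,f_+:\mathbb{R}\to\mathbb{R}$ are twice continuously differentiable. The sonic point $u^\star_\pm$ is the point where $f_\pm'$ vanishes (with $u^\star_\pm=-\infty$ if $f_\pm'>0$ everywhere and $+\infty$ if $f_\pm'<0$ everywhere). Given $(u_L,u_R)\in\mathbb{R}^2$, $M>0$ is $M=\sup_{u}\left(|f_-'(u)|+|f_+'(u)|\right)$, the supremum being over the closed interval with endpoints $u_L,u_R$. For $\epsilon>0$, $(u^\epsilon,v^\epsilon)$ denotes a solution on $[-M,M]$ of $$-\xi \frac{du^\epsilon}{d\xi} + \tfrac12\left((1-v^\epsilon)f_-'(u^\epsilon)+(1+v^\epsilon) f_+'(u^\epsilon)\right)\frac{du^\epsilon}{d\xi} = \epsilon \frac{d^2u^\epsilon}{d\xi^2},\qquad -\xi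 \frac{dv^\epsilon}{d\xi} = \epsilon^2 \frac{d^2v^\epsilon}{d\xi^2},$$ with $u^\epsilon(-M)=u_L$, $u^\epsilon(M)=u_R$, $v^\epsilon(-M)=-1$, $v^\epsilon(M)=+1$ (extended by these constants outside $[-M,M]$). A coupled Riemann-Dafermos (CRD) solution associated with $(u_L,u_R)$ is a function $u\in L^\infty(\mathbb{R})\cap BV(\mathbb{R})$ that is the limit in $L^1_{\mathrm{loc}}$, as $\epsilon\to0$, of a convergent subsequence of such $u^\epsilon$. CRD solutions are known to be monotone in $\xi$ and to be self-similar entropy solutions, in $\xi=x/t$, of $\partial_tu+\partial_xf_-(u)=0$ for $\xi<0$ and of $\partial_tu+\partial_xf_+(u)=0$ for $\xi>0$. For a bounded function $u$ of $\xi\in[-M,M]$, $h(\xi;u)=\int_0^\xi \left(s- f'_-(u(s))\,\mathbf{1}_{s<0} - f'_+(u(s))\,\mathbf{1}_{s>0}\right)ds$. A double-waved function with data $(u_L,u_R)$ and intermediate state $\bar u$ is a monotone function of $\xi$ with $\bar u$ strictly between $u_L$ and $u_R$ consisting of a wave for $f_-$ (rarefaction if $u_L<\bar u$, entropy shock if $u_L>\bar u$) with negative speeds connecting $u_L$ to $\bar u$, then the constant $\bar u$ in a neighbourhood of $\xi=0$, then a wave for $f_+$ (rarefaction if $\bar u<u_R$, entropy shock if $\bar u>u_R$) with positive speeds connecting $\bar u$ to $u_R$. *)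

(* Defs.v *)
From HB Require Import structures.
From mathcomp Require Import all_boot all_order all_algebra.
From mathcomp Require Import all_classical all_reals all_analysis.

Set Implicit Arguments.
Unset Strict Implicit.
Unset Printing Implicit Defensive.

Import Order.TTheory GRing.Theory Num.Theory.
Import numFieldNormedType.Exports.

Local Open Scope ring_scope.
Local Open Scope classical_set_scope.

(* In ring_scope these notations would denote the derivatives of polynomials. *)
Local Notation "f ^` ()" := (derive1 f) : ring_scope.
Local Notation "f ^` ( n )" := (derive1n n f) : ring_scope.

Section CoupledRiemannDafermos.
Variable R : realType.
Implicit Types (f fm fp u v w h : R -> R) (a b uL uR ubar eps xi : R).

Local Notation mu := (@lebesgue_measure R).

(** Fluxes; throughout, [fm] is the flux $f_-$ and [fp] is the flux $f_+$. *)

Definition twice_cont_diff f : Prop :=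
  [/\ forall x, derivable f x 1, forall x, derivable f^`() x 1
    & continuous f^`(2)].

Definition strictly_convex f : Prop :=
  forall (x y t : R), x != y -> 0 < t -> t < 1 ->
    f (t * x + (1 - t) * y) < t * f x + (1 - t) * f y.

Definition is_sonic_point f (us : \bar R) : Prop :=
  match us with
  | r%:E => f^`() r = 0
  | -oo%E => forall x, 0 < f^`() x
  | +oo%E => forall x, f^`() x < 0
  end.

(** The half-length $M$ of the domain of the viscous problem. *)
Definition max_speed fm fp uL uR : R :=
  sup [set `|fm^`() w| + `|fp^`() w| | w in `[Num.min uL uR, Num.max uL uR]].

(** Since the coefficients are continuous on [-M, M], a function that is
    continuous there and satisfies the equations in the interior is a classical
    solution up to the boundary. *)
Definition dafermos_solution fm fp uL uR eps u v : Prop :=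
  let M := max_speed fm fp uL uR in
  [/\ (forall xi, xi <= - M -> u xi = uL /\ v xi = -1),
      (forall xi, M <= xi -> u xi = uR /\ v xi = 1),
      {within `[- M, M], continuous u},
      {within `[- M, M], continuous v}
    & forall xi, - M < xi < M ->
      [/\ derivable u xi 1 /\ derivable u^`() xi 1,
          derivable v xi 1 /\ derivable v^`() xi 1,
          - xi * u^`() xi
            + 2^-1 * ((1 - v xi) * fm^`() (u xi) + (1 + v xi) * fp^`() (u xi))
              * u^`() xi
          = eps * u^`(2) xi
        & - xi * v^`() xi = eps ^+ 2 * v^`(2) xi]].

(** $BV(\mathbb{R})$ is understood as finite total variation of some almost
    everywhere representative; integrability on $\mathbb{R}$ is not required,
    as these functions are constant and in general nonzero near infinity. *)
Definition finite_total_variation u : Prop :=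
  exists w, {ae mu, forall x, u x = w x} /\
  exists C : R, forall a b, a <= b -> (total_variation a b w <= C%:E)%E.

Definition L1loc_cvg (un : nat -> R -> R) u : Prop :=
  forall K : set R, compact K ->
    (fun n => \int[mu]_(x in K) (`|un n x - u x|%:E))%E @ \oo --> 0%E.

Definition CRD_solution fm fp uL uR u : Prop :=
  [/\ u \in Lfun mu +oo%E,
      finite_total_variation u
    & exists (eps : nat -> R) (un vn : nat -> R -> R),
      [/\ forall n, 0 < eps n,
          eps @ \oo --> (0 : R),
          forall n, dafermos_solution fm fp uL uR (eps n) (un n) (vn n)
        & L1loc_cvg un u]].

(** Waves as functions of $\xi = x/t$, for a convex flux [f], with left state
    [a] and right state [b]; [D] is the set of $\xi$ on which the function is
    prescribed. In a rarefaction fan the value is $(f')^{-1}(\xi)$. *)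

Definition rarefaction f a b (D : set R) u : Prop :=
  a < b /\ forall xi, D xi ->
    [/\ xi <= f^`() a -> u xi = a,
        f^`() a <= xi <= f^`() b -> a <= u xi <= b /\ f^`() (u xi) = xi
      & f^`() b <= xi -> u xi = b].

Definition shock_speed f a b : R := (f b - f a) / (b - a).

(** The value at the jump itself is left free. *)
Definition entropy_shock f a b (D : set R) u : Prop :=
  b < a /\ forall xi, D xi ->
    (xi < shock_speed f a b -> u xi = a) /\
    (shock_speed f a b < xi -> u xi = b).

Definition wave f a b (D : set R) u : Prop :=
  rarefaction f a b D u \/ entropy_shock f a b D u.

Definition wave_speeds f a b : set R :=
  if a < b then `[f^`() a, f^`() b] else [set shock_speed f a b].

Definition monotone_fun u : Prop :=
  {homo u : x y / x <= y} \/ {homo u : x y /~ x <= y}.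

Definition double_waved fm fp uL uR ubar u : Prop :=
  [/\ monotone_fun u,
      uL < ubar < uR \/ uR < ubar < uL,
      wave fm uL ubar `]-oo, 0[ u /\ wave_speeds fm uL ubar `<=` `]-oo, 0[,
      \forall xi \near (0 : R), u xi = ubar
    & wave fp ubar uR `]0, +oo[ u /\ wave_speeds fp ubar uR `<=` `]0, +oo[].

Definition oriented_integral f a b : R :=
  if a <= b then (\int[mu]_(s in `[a, b]) f s)%R
  else - (\int[mu]_(s in `[b, a]) f s)%R.

Definition hfun fm fp u xi : R :=
  oriented_integral
    (fun s => s - fm^`() (u s) * (s < 0)%R%:R - fp^`() (u s) * (0 < s)%R%:R)
    0 xi.

Definition is_min_on h a b (m : R) : Prop :=
  (exists2 xi, a <= xi <= b & h xi = m) /\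
  (forall xi, a <= xi <= b -> m <= h xi).

Definition selection_criterion fm fp uL uR u : Prop :=
  let M := max_speed fm fp uL uR in
  exists m, is_min_on (hfun fm fp u) (- M) 0 m /\
            is_min_on (hfun fm fp u) 0 M m.

End CoupledRiemannDafermos.

(* Main.v *)
Require Import Defs.
From HB Require Import structures.
From mathcomp Require Import all_boot all_order all_algebra.
From mathcomp Require Import all_classical all_reals all_analysis.
From mathcomp Require Import measurable_realfun ring lra.

(** Why the proposition holds.

    Selection.  In a viscous profile the equation for [u] is linear of first
    order in [u'], so [u' = c * exp (- F / eps)], where [F] is a primitive of
    [xi] minus the blended speed ([linear_ode_exponential],
    [dafermos_exponential_profile]).  As [eps] tends to [0], [F] converges
    uniformly to [h] up to a constant.  The increments of the profile over the
    left and the right half of the domain are therefore Laplace integrals, of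
    size [exp (- min h / eps)], with the minimum taken over the half in
    question.  Were the two minima different, one increment would be
    negligible against the other; but the increments tend to [ubar - uL] and
    [uR - ubar], neither of which vanishes.  The mean value theorem is enough
    to compare the increments ([exponential_profile_balance]), so no integral
    of an exponential is evaluated.

    Convergence of [F] to [h] ([primitive_gap]).  The difference is at most the
    integral of the difference of the speeds.  The derivatives of the fluxes
    are Lipschitz on the range of the profiles, which leaves the [L^1] distance
    of the profiles, and the colour function [v] is within
    [2 * eps^2 / d^2] of [-1] or [1] at distance [d] from the interface
    ([heat_profile_bounds]).  The value at [0] of a monotone profile tends to
    [ubar] because the limit is constant near [0] ([interface_value_gap]).

    Uniqueness.  For a double wave with middle state [b], let [sm] be the
    speed of the left wave that is closest to [0].  Then [h] does not increase
    up to [sm] and is the parabola [xi^2 / 2 - fm'(b) * xi] from [sm] to [0],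
    so its left minimum is [sm^2 / 2 - fm'(b) * sm], where [fm'(b) <= sm < 0]; the
    right minimum has the same form.  Both [sm] and [fm'(b)] increase with
    [b], and the left minimum strictly increases whereas the right minimum
    strictly decreases ([parabola_min_lt]): they agree for at most one [b].
    The inequalities [fm'(b) <= sm < 0], and their mirror images on the right,
    also place [b] between the sonic points. *)

Set Implicit Arguments.
Unset Strict Implicit.
Unset Printing Implicit Defensive.

Import Order.TTheory GRing.Theory Num.Theory.
Import numFieldNormedType.Exports.

Local Open Scope ring_scope.
Local Open Scope classical_set_scope.

Local Notation "f ^` ()" := (derive1 f) : ring_scope.
Local Notation "f ^` ( n )" := (derive1n n f) : ring_scope.

(** * Convex fluxes and chord slopes *)

Section ConvexFlux.
Context {R : realType}.
Implicit Types (f : R -> R) (a b x y : R).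

Definition convex_flux f := (forall z, derivable f z 1) /\ strictly_convex f.

(** The weak inequality is a limit of chord inequalities; strictness comes from
    applying it at the midpoint, which lies strictly below the chord. *)
Lemma convex_flux_tangent f x y : convex_flux f -> x != y ->
  f x + f^`() x * (y - x) < f y.
Proof.
move=> [df fcvx] xy.
have weak z : x != z -> f^`() x * (z - x) <= f z - f x.
  move=> xz.
  have df1 : differentiable f x := (derivable1_diffP f x).1 (df x).
  have dfz : derivable f x (z - x) := @diff_derivable _ _ _ f x (z - x) df1.
  have Dfz : 'D_(z - x) f x = f^`() x * (z - x).
    rewrite derive1E (deriveE (z - x) df1) (deriveE (1 : R^o) df1).
    by rewrite -{1}[z - x]mulr1 -[_ * 1]/(_ *: 1) linearZ/= mulrC.
  rewrite -Dfz /derive cvg_at_rightE; last exact: dfz.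
  apply: limr_le.
    apply: (cvgP (('D_(z - x) f x))).
    by apply: cvg_dnbhs_at_right; exact: dfz.
  near=> t.
  have t0 : 0 < t by near: t; exact: nbhs_right_gt.
  have t1 : t < 1 by near: t; exact: nbhs_right_lt.
  rewrite -[_ *: _]/(_ * _) mulrC ler_pdivrMr//.
  have := fcvx z x t; rewrite eq_sym => /(_ xz t0 t1).
  rewrite (_ : t * z + (1 - t) * x = t *: (z - x) + x); last first.
    by rewrite -[t *: _]/(t * _); ring.
  rewrite /=; set F := f _; set X := f x; set Z := f z => /ltW FXZ.
  by rewrite mulrC; lra.
pose m := 2^-1 * x + (1 - 2^-1) * y.
have xm : x != m.
  apply: contra_neq xy; rewrite /m => e; apply/eqP; rewrite -subr_eq0.
  by rewrite (_ : x - y = 2 * (x - (2^-1 * x + (1 - 2^-1) * y)));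
    [rewrite -e subrr mulr0|field].
have := weak m xm; have := fcvx x y 2^-1 xy; rewrite -/m.
rewrite invr_gt0 ltr0n => /(_ isT); rewrite invf_lt1 ?ltr0n// ltr1n => /(_ isT).
rewrite /m; set D := f^`() x; set m' := f (_ + _); move=> ? h.
have : D * (2^-1 * x + (1 - 2^-1) * y - x) = 2^-1 * (D * (y - x)) by field.
by move=> e; rewrite e in h; lra.
Unshelve. all: by end_near. Qed.

Lemma shock_speedC f a b : shock_speed f a b = shock_speed f b a.
Proof. by rewrite /shock_speed -[in RHS](opprB b a) -[in RHS](opprB (f b)) invrN mulrNN. Qed.

Lemma shock_speed_itv f a b : convex_flux f -> b < a ->
  f^`() b < shock_speed f a b < f^`() a.
Proof.
move=> cf ba; rewrite shock_speedC /shock_speed.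
rewrite ltr_pdivlMr ?ltr_pdivrMr ?subr_gt0//.
have := convex_flux_tangent cf (negbT (lt_eqF ba)).
have := convex_flux_tangent cf (negbT (gt_eqF ba)).
by move=> ? ?; apply/andP; split; lra.
Qed.

Lemma convex_flux_derive1_lt f : convex_flux f -> {homo f^`() : x y / x < y}.
Proof. by move=> cf x y /(shock_speed_itv cf)/andP[]; exact: lt_trans. Qed.

Lemma convex_flux_derive1_le f : convex_flux f -> {homo f^`() : x y / x <= y}.
Proof. by move=> cf; apply: ltW_homo; exact: convex_flux_derive1_lt. Qed.

(** Cut the longer of the two chords at the end of the shorter one and compare
    the part cut off with the tangent at that point. *)
Lemma shock_speed_homo f a b b' : convex_flux f ->
  b < b' -> (b' < a \/ a < b) ->
  shock_speed f a b < shock_speed f a b'.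
Proof.
move=> cf bb' [b'a|ab].
- have tangent := convex_flux_tangent cf (negbT (gt_eqF bb')).
  have /andP[Db' _] := shock_speed_itv cf b'a.
  rewrite ![shock_speed f a _]shock_speedC in Db' *.
  have eb' : f a - f b' = shock_speed f b' a * (a - b').
    by rewrite /shock_speed divfK// subr_eq0 gt_eqF.
  rewrite {1}/shock_speed ltr_pdivrMr ?subr_gt0 ?(lt_trans bb')//.
  have : f^`() b' * (b' - b) < shock_speed f b' a * (b' - b).
    by rewrite ltr_pM2r ?subr_gt0.
  by move: tangent eb' => {Db'}; lra.
- have tangent := convex_flux_tangent cf (negbT (lt_eqF bb')).
  have := shock_speed_itv cf ab; rewrite shock_speedC => /andP[_ Db].
  have eb : f b - f a = shock_speed f a b * (b - a).
    by rewrite /shock_speed divfK// subr_eq0 gt_eqF.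
  rewrite [ltRHS]/shock_speed ltr_pdivlMr ?subr_gt0 ?(lt_trans ab)//.
  have : shock_speed f a b * (b' - b) < f^`() b * (b' - b).
    by rewrite ltr_pM2r ?subr_gt0.
  by move: tangent eb => {Db}; lra.
Qed.

End ConvexFlux.

(** * Integrals over segments *)

Section IntervalIntegral.
Context {R : realType}.
Local Notation mu := (@lebesgue_measure R).
Implicit Types (k p : R -> R) (a b c d x y M : R).

Definition segment_integrable k :=
  forall a b, mu.-integrable `[a, b] (EFin \o k).

Lemma Rintegral_itv_chasles k a b c : segment_integrable k ->
  a <= b -> b <= c ->
  (\int[mu]_(s in `[a, c]) k s = \int[mu]_(s in `[a, b]) k s +
                                 \int[mu]_(s in `[b, c]) k s)%R.
Proof.
move=> ik ab bc.
have := @Rintegral_itvB _ k (BLeft a) (BRight c) b (ik a c).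
rewrite !bnd_simp => /(_ ab bc) /eqP.
rewrite subr_eq addrC => /eqP ->; congr (_ + _).
rewrite Rintegral_itv_obnd_cbnd//.
by apply: integrableS (ik b c) => //; apply: subset_itv; rewrite bnd_simp.
Qed.

Lemma oriented_integralB k x y : segment_integrable k -> x <= y ->
  oriented_integral k 0 y - oriented_integral k 0 x =
  (\int[mu]_(s in `[x, y]) k s)%R.
Proof.
move=> ik xy; rewrite /oriented_integral.
have [x0|x0] := leP 0 x.
  rewrite (le_trans x0 xy) (Rintegral_itv_chasles ik x0 xy).
  by rewrite addrAC subrr add0r.
have [y0|y0] := leP 0 y.
  by rewrite (Rintegral_itv_chasles ik (ltW x0) y0) opprK addrC.
by rewrite (Rintegral_itv_chasles ik xy (ltW y0)) opprK addrC addrK.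
Qed.

Lemma Rintegral_itv_cc_oo k x y : segment_integrable k ->
  (\int[mu]_(s in `[x, y]) k s = \int[mu]_(s in `]x, y[) k s)%R.
Proof.
move=> ik; rewrite -Rintegral_itv_obnd_cbnd; last first.
  by apply: integrableS (ik x y) => //; apply: subset_itv; rewrite bnd_simp.
rewrite -Rintegral_itv_bndo_bndc//.
by apply: integrableS (ik x y) => //; apply: subset_itv; rewrite bnd_simp.
Qed.

Lemma le_Rintegral_itv k k' x y :
  segment_integrable k -> segment_integrable k' ->
  (forall s, x < s < y -> k s <= k' s) ->
  (\int[mu]_(s in `[x, y]) k s <= \int[mu]_(s in `[x, y]) k' s)%R.
Proof.
move=> ik ik' kk'; rewrite !Rintegral_itv_cc_oo//.
apply: le_Rintegral => //.
- by apply: integrableS (ik x y) => //; apply: subset_itv; rewrite bnd_simp.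
- by apply: integrableS (ik' x y) => //; apply: subset_itv; rewrite bnd_simp.
Qed.

Lemma continuous_segment_integrable k : continuous k -> segment_integrable k.
Proof.
move=> ck a b; apply: continuous_compact_integrable; first exact: segment_compact.
exact: continuous_subspaceT.
Qed.

Lemma Rintegral_itv_affine c x y : x <= y ->
  (\int[mu]_(s in `[x, y]) (s - c) = 2^-1 * (y ^+ 2 - x ^+ 2) - c * (y - x))%R.
Proof.
rewrite le_eqVlt => /predU1P[->|xy].
  by rewrite set_itv1 Rintegral_set1 !subrr !mulr0 subrr.
pose F (s : R) : R := 2^-1 * s ^+ 2 - c * s.
have dF (s : R) : is_derive s 1 F (s - c).
  rewrite /F; apply: is_derive_eq.
  by rewrite /= -![_ *: _]/(_ * _); field.
rewrite /Rintegral (@continuous_FTC2 _ (fun s => s - c) F)//.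
- by rewrite -EFinB/= /F; ring.
- by apply: continuous_subspaceT => s; apply: cvgB; [exact: cvg_id|exact: cvg_cst].
- have dd (s : R) : derivable F s 1 by [].
  have cF (s : R) : {for s, continuous F} by apply/differentiable_continuous/derivable1_diffP.
  split=> //.
  + exact: cvg_at_right_filter (cF _).
  + exact: cvg_at_left_filter (cF _).
- by move=> s _; rewrite derive1E; exact: derive_val.
Qed.

Lemma oriented_integral_nondecreasing k x y : segment_integrable k -> x <= y ->
  (forall s, x < s < y -> 0 <= k s) ->
  oriented_integral k 0 x <= oriented_integral k 0 y.
Proof.
move=> ik xy k0; rewrite -subr_ge0 oriented_integralB// Rintegral_itv_cc_oo//.
by apply: Rintegral_ge0 => s /=; rewrite in_itv/=; exact: k0.
Qed.

Lemma oriented_integral_nonincreasing k x y : segment_integrable k -> x <= y ->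
  (forall s, x < s < y -> k s <= 0) ->
  oriented_integral k 0 y <= oriented_integral k 0 x.
Proof.
move=> ik xy k0; rewrite -subr_le0 oriented_integralB//.
have := @le_Rintegral_itv k (cst 0) x y ik.
rewrite /= Rintegral_cst// mul0r; apply=> //.
by apply: continuous_segment_integrable; exact: cst_continuous.
Qed.

Lemma oriented_integral_affine k c x y : segment_integrable k -> x <= y ->
  (forall s, x < s < y -> k s = s - c) ->
  oriented_integral k 0 y - oriented_integral k 0 x =
  2^-1 * (y ^+ 2 - x ^+ 2) - c * (y - x).
Proof.
move=> ik xy kc; rewrite oriented_integralB// -Rintegral_itv_affine//.
have ia : segment_integrable (fun s => s - c).
  by apply: continuous_segment_integrable => s; apply: cvgB; [exact: cvg_id|exact: cvg_cst].
rewrite (Rintegral_itv_cc_oo _ _ ik) (Rintegral_itv_cc_oo _ _ ia).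
by apply: eq_Rintegral => s; rewrite inE/= in_itv/=; exact: kc.
Qed.

Lemma oriented_integral00 k : oriented_integral k 0 0 = 0.
Proof. by rewrite /oriented_integral lexx set_itv1 Rintegral_set1. Qed.

Lemma segment_integrableD k k' : segment_integrable k -> segment_integrable k' ->
  segment_integrable (fun s => k s + k' s).
Proof. by move=> ik ik' a b; exact: (integrableD _ (ik a b) (ik' a b)). Qed.

Lemma segment_integrableB k k' : segment_integrable k -> segment_integrable k' ->
  segment_integrable (fun s => k s - k' s).
Proof. by move=> ik ik' a b; exact: (integrableB _ (ik a b) (ik' a b)). Qed.

Lemma segment_integrableZ c k : segment_integrable k ->
  segment_integrable (fun s => c * k s).
Proof. by move=> ik a b; exact: (integrableZl _ c (ik a b)). Qed.

Lemma segment_integrable_norm k : segment_integrable k ->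
  segment_integrable (fun s => `|k s|).
Proof. by move=> ik a b; exact: (integrable_norm (ik a b)). Qed.

Lemma bounded_segment_integrable k c : measurable_fun setT k ->
  (forall s, `|k s| <= c) -> segment_integrable k.
Proof.
move=> mk kc x y; apply: measurable_bounded_integrable => //.
- rewrite /= lebesgue_measure_itv/=.
  by case: ifP => _; rewrite ?ltry// -EFinB ltry.
- exact: measurable_funS mk.
- exists c; split; first exact: num_real.
  by move=> C cC s _; apply: ltW; apply: le_lt_trans cC; exact: kc.
Qed.

Lemma segment_integrable_indic a b : segment_integrable (\1_`[a, b] : R -> R).
Proof.
apply: (@bounded_segment_integrable _ 1) => // s.
by rewrite indicE; case: (_ \in _); rewrite ?normr1 ?normr0.
Qed.

Lemma Rintegral_itv_cst c a b : a <= b ->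
  (\int[mu]_(s in `[a, b]) c = c * (b - a))%R.
Proof.
move=> ab; rewrite Rintegral_cst//= lebesgue_measure_itv/= lte_fin.
move: ab; rewrite le_eqVlt => /predU1P[->|->]; last by rewrite -EFinB.
by rewrite ltxx subrr.
Qed.

Lemma Rintegral_itv_indic d M : 0 <= d -> d <= M ->
  (\int[mu]_(s in `[- M, M]) (\1_`[- d, d] : R -> R) s = 2 * d)%R.
Proof.
move=> d0 dM; rewrite /Rintegral integral_indic//= setIidl; last first.
  by apply: subset_itv; rewrite bnd_simp// lerN2.
rewrite lebesgue_measure_itv/= lte_fin; case: ifPn => [_|].
  by rewrite -EFinB/=; ring.
by rewrite -leNgt => dd /=; lra.
Qed.

Lemma normr_Rintegral_le k p x y : segment_integrable k -> segment_integrable p ->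
  (forall s, x < s < y -> `|k s| <= p s) ->
  `|\int[mu]_(s in `[x, y]) k s| <= (\int[mu]_(s in `[x, y]) p s)%R.
Proof.
move=> ik ip kp; apply: (@le_trans _ _ (\int[mu]_(s in `[x, y]) `|k s|)%R).
  exact: le_normr_Rintegral.
exact: le_Rintegral_itv (segment_integrable_norm ik) ip kp.
Qed.

Lemma Rintegral_itv_mono p a b x y : segment_integrable p ->
  (forall s, 0 <= p s) -> a <= x -> x <= y -> y <= b ->
  (\int[mu]_(s in `[x, y]) p s <= \int[mu]_(s in `[a, b]) p s)%R.
Proof.
move=> ip p0 ax xy yb.
rewrite (Rintegral_itv_chasles ip ax (le_trans xy yb)).
rewrite (Rintegral_itv_chasles ip xy yb) addrCA lerDl.
by apply: addr_ge0; apply: Rintegral_ge0.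
Qed.

End IntervalIntegral.

(** * Double waves and their edges *)

Section DoubleWaves.
Context {R : realType}.
Implicit Types (f fm fp u w : R -> R) (a b uL uR x y z xi : R) (D : set R).

(** The ends of the speed interval of a wave from [a] to [b].  They coincide
    for a shock, which lets fans and shocks be treated together. *)
Definition slowest_speed f a b := if a < b then f^`() a else shock_speed f a b.
Definition fastest_speed f a b := if a < b then f^`() b else shock_speed f a b.

Lemma wave_speeds_edges f a b : convex_flux f ->
  wave_speeds f a b (slowest_speed f a b) /\
  wave_speeds f a b (fastest_speed f a b).
Proof.
move=> cf; rewrite /wave_speeds /slowest_speed /fastest_speed.
case: ifPn => // ab; rewrite /= !in_itv/= !lexx/= andbT.
by split; exact/ltW/convex_flux_derive1_lt.
Qed.

Lemma edges_derive1 f a b : convex_flux f -> a != b ->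
  slowest_speed f a b <= f^`() a /\ f^`() b <= fastest_speed f a b.
Proof.
move=> cf; rewrite /slowest_speed /fastest_speed neq_lt => /orP[ab|ba].
  by rewrite ab.
by rewrite ltNge (ltW ba)/=; have /andP[/ltW ? /ltW ?] := shock_speed_itv cf ba.
Qed.

Lemma wave_speeds_norm_le f a b s C : convex_flux f -> a != b ->
  `|f^`() a| <= C -> `|f^`() b| <= C -> wave_speeds f a b s -> `|s| <= C.
Proof.
move=> cf; rewrite !ler_norml neq_lt /wave_speeds => /orP[ab|ba].
  rewrite ab => /andP[? ?] /andP[? ?] /=; rewrite in_itv/= => /andP[? ?].
  by apply/andP; split; lra.
rewrite ltNge (ltW ba)/= => /andP[? ?] /andP[? ?] ->.
by have /andP[? ?] := shock_speed_itv cf ba; apply/andP; split; lra.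
Qed.

(** The last two conclusions are the sign of the derivative
    [xi - f' (u xi)] of the functional [h] before the end and after the
    beginning of the wave: inside a fan they are equalities, on the two sides
    of a shock they are the Lax inequalities. *)
Lemma wave_profile f a b D u : convex_flux f -> wave f a b D u ->
  forall xi, D xi ->
  [/\ xi < slowest_speed f a b -> u xi = a,
      fastest_speed f a b < xi -> u xi = b,
      xi < fastest_speed f a b -> xi <= f^`() (u xi)
    & slowest_speed f a b < xi -> f^`() (u xi) <= xi].
Proof.
move=> cf; rewrite /slowest_speed /fastest_speed.
case=> -[ab uD] xi /uD.
  rewrite ab => -[ua fan ub].
  have fab := convex_flux_derive1_lt cf ab.
  split=> [/ltW/ua//|/ltW/ub//|h|h].
  - have [h'|h'] := leP xi (f^`() a); first by rewrite ua.
    by case: fan => [|_ ->]; rewrite ?(ltW h) ?(ltW h').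
  - have [h'|h'] := leP (f^`() b) xi; first by rewrite ub.
    by case: fan => [|_ ->]; rewrite ?(ltW h) ?(ltW h').
have -> : (a < b) = false by rewrite ltNge (ltW ab).
move=> [ua ub].
have /andP[s_b s_a] := shock_speed_itv cf ab.
by split=> // h; [rewrite ua// ltW// (lt_trans h)|rewrite ub// ltW// (lt_trans _ h)].
Qed.

Lemma wave_neq f a b D u : wave f a b D u -> a != b.
Proof. by case=> -[ab _]; rewrite ?(lt_eqF ab)// (gt_eqF ab). Qed.

Section OneDoubleWave.
Variables (fm fp : R -> R) (uL uR b : R) (w : R -> R).
Hypotheses (cfm : convex_flux fm) (cfp : convex_flux fp).
Hypothesis dw : double_waved fm fp uL uR b w.

Lemma double_waved_left (s := fastest_speed fm uL b) :
  [/\ s < 0, fm^`() b <= s, forall xi, s < xi < 0 -> w xi = b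
    & forall xi, xi < s -> xi <= fm^`() (w xi)].
Proof.
case: dw => _ _ [wl sl] _ _.
have [_ /sl/=] := wave_speeds_edges uL b cfm; rewrite in_itv/= => s0.
split=> //.
- by case: (edges_derive1 cfm (wave_neq wl)).
- move=> xi /andP[sx x0]; have [|_ + _ _] := wave_profile cfm wl (xi := xi).
    by rewrite /= in_itv.
  exact.
- move=> xi xs; have [|_ _ + _] := wave_profile cfm wl (xi := xi).
    by rewrite /= in_itv/= (lt_trans xs).
  exact.
Qed.

Lemma double_waved_right (s := slowest_speed fp b uR) :
  [/\ 0 < s, s <= fp^`() b, forall xi, 0 < xi < s -> w xi = b
    & forall xi, s < xi -> fp^`() (w xi) <= xi].
Proof.
case: dw => _ _ _ _ [wr sr].
have [/sr/= + _] := wave_speeds_edges b uR cfp; rewrite in_itv/= andbT => s0.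
split=> //.
- by case: (edges_derive1 cfp (wave_neq wr)).
- move=> xi /andP[x0 xs]; have [|+ _ _ _] := wave_profile cfp wr (xi := xi).
    by rewrite /= in_itv/= x0.
  exact.
- move=> xi sx; have [|_ _ _] := wave_profile cfp wr (xi := xi).
    by rewrite /= in_itv/= (lt_trans s0).
  exact.
Qed.

(** A monotone function is bounded by its values far away on either side, and
    there it takes the values [uL] and [uR]. *)
Lemma double_waved_range xi : Num.min uL uR <= w xi <= Num.max uL uR.
Proof.
case: dw => mon _ [wl sl] _ [wr sr].
have wmin : exists2 x, x <= xi & w x = uL.
  exists (Num.min xi (Num.min 0 (slowest_speed fm uL b)) - 1).
    have : Num.min xi (Num.min 0 (slowest_speed fm uL b)) <= xi by rewrite ge_min lexx.
    by lra.
  set x := _ - 1; have [|+ _ _ _] := wave_profile cfm wl (xi := x).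
    rewrite /= in_itv/= /x.
    have : Num.min xi (Num.min 0 (slowest_speed fm uL b)) <= 0 by rewrite !ge_min lexx orbT.
    by lra.
  apply; rewrite /x; set s := slowest_speed _ _ _.
  have : Num.min xi (Num.min 0 s) <= s by rewrite !ge_min lexx !orbT.
  by lra.
have wmax : exists2 x, xi <= x & w x = uR.
  exists (Num.max xi (Num.max 0 (fastest_speed fp b uR)) + 1).
    have : xi <= Num.max xi (Num.max 0 (fastest_speed fp b uR)) by rewrite le_max lexx.
    by lra.
  set x := _ + 1; have [|_ + _ _] := wave_profile cfp wr (xi := x).
    rewrite /= in_itv/= andbT /x.
    have : 0 <= Num.max xi (Num.max 0 (fastest_speed fp b uR)) by rewrite !le_max lexx orbT.
    by lra.
  apply; rewrite /x; set s := fastest_speed _ _ _.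
  have : s <= Num.max xi (Num.max 0 s) by rewrite !le_max lexx !orbT.
  by lra.
case: wmin => x xxi wx; case: wmax => y xiy wy.
rewrite ge_min le_max; case: mon => mon.
  by have := mon _ _ xxi; have := mon _ _ xiy; rewrite wx wy => -> ->; rewrite orbT.
by have := mon _ _ xxi; have := mon _ _ xiy; rewrite wx wy => -> ->; rewrite orbT.
Qed.

Lemma double_waved_between : Num.min uL uR < b < Num.max uL uR.
Proof.
case: dw => _ + _ _ _; rewrite gt_min lt_max.
by case=> /andP[-> ->]; rewrite ?orbT.
Qed.

End OneDoubleWave.

Lemma derive1_norm_le f a b x : convex_flux f -> a <= x <= b ->
  `|f^`() x| <= `|f^`() a| + `|f^`() b|.
Proof.
move=> cf /andP[/(convex_flux_derive1_le cf) ax /(convex_flux_derive1_le cf) xb].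
have := ler_norm (f^`() b); have := normr_ge0 (f^`() b).
have := ler_norm (- f^`() a); have := normr_ge0 (f^`() a); rewrite normrN.
by rewrite ler_norml => ? ? ? ?; apply/andP; split; lra.
Qed.

Lemma max_speed_ge fm fp uL uR x : convex_flux fm -> convex_flux fp ->
  Num.min uL uR <= x <= Num.max uL uR ->
  `|fm^`() x| + `|fp^`() x| <= max_speed fm fp uL uR.
Proof.
move=> cfm cfp xI; rewrite /max_speed.
set lo := Num.min uL uR in xI *; set hi := Num.max uL uR in xI *.
apply: ub_le_sup; last by exists x => //=; rewrite in_itv.
exists ((`|fm^`() lo| + `|fm^`() hi|) + (`|fp^`() lo| + `|fp^`() hi|)).
move=> _ /= [z + <-]; rewrite in_itv/= => zI.
by apply: lerD; exact: derive1_norm_le.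
Qed.

Lemma max_speed_gt0 fm fp uL uR : convex_flux fm -> convex_flux fp ->
  uL != uR -> 0 < max_speed fm fp uL uR.
Proof.
move=> cfm cfp uLR.
have hL := @max_speed_ge _ _ uL uR uL cfm cfp; have hR := @max_speed_ge _ _ uL uR uR cfm cfp.
rewrite !ge_min !le_max !lexx !orbT /= in hL hR.
move: {hL} (hL isT) {hR} (hR isT).
have : 0 < `|fm^`() uL| + `|fm^`() uR|.
  rewrite lt_neqAle addr_ge0// andbT eq_sym paddr_eq0// !normr_eq0.
  apply/negP => /andP[/eqP eL /eqP eR].
  move: uLR; rewrite neq_lt => /orP[] /(convex_flux_derive1_lt cfm).
    by rewrite eL eR ltxx.
  by rewrite eL eR ltxx.
have := normr_ge0 (fp^`() uL); have := normr_ge0 (fp^`() uR).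
by lra.
Qed.

Section EdgesInDomain.
Variables (fm fp : R -> R) (uL uR b : R) (w : R -> R).
Hypotheses (cfm : convex_flux fm) (cfp : convex_flux fp).
Hypothesis dw : double_waved fm fp uL uR b w.
Let M := max_speed fm fp uL uR.

Lemma double_waved_neq : uL != uR.
Proof.
by apply/eqP => e; have := double_waved_between dw; rewrite e minxx maxxx; lra.
Qed.

Let speed_le x : Num.min uL uR <= x <= Num.max uL uR ->
  `|fm^`() x| <= M /\ `|fp^`() x| <= M.
Proof.
move=> /(max_speed_ge cfm cfp); rewrite -/M.
have := normr_ge0 (fm^`() x); have := normr_ge0 (fp^`() x).
by split; lra.
Qed.

Let bI : Num.min uL uR <= b <= Num.max uL uR.
Proof. by have /andP[/ltW -> /ltW ->] := double_waved_between dw. Qed.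

Let uLI : Num.min uL uR <= uL <= Num.max uL uR.
Proof. by rewrite ge_min le_max lexx. Qed.

Let uRI : Num.min uL uR <= uR <= Num.max uL uR.
Proof. by rewrite ge_min le_max lexx !orbT. Qed.

Lemma left_edge_ge : - M <= fastest_speed fm uL b.
Proof.
case: dw => _ _ [wl _] _ _.
have [_ h] := wave_speeds_edges uL b cfm.
have := wave_speeds_norm_le cfm (wave_neq wl) (speed_le uLI).1 (speed_le bI).1 h.
by rewrite ler_norml => /andP[].
Qed.

Lemma right_edge_le : slowest_speed fp b uR <= M.
Proof.
case: dw => _ _ _ _ [wr _].
have [h _] := wave_speeds_edges b uR cfp.
have := wave_speeds_norm_le cfp (wave_neq wr) (speed_le bI).2 (speed_le uRI).2 h.
by rewrite ler_norml => /andP[].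
Qed.

End EdgesInDomain.

End DoubleWaves.

(** * The functional h along a double wave *)

Section SelectionFunctional.
Context {R : realType}.
Implicit Types (f fm fp u w h : R -> R) (a b uL uR x y z xi : R).

(** The integrand of [hfun]. *)
Definition limit_slope fm fp w (s : R) : R :=
  s - fm^`() (w s) * (s < 0)%R%:R - fp^`() (w s) * (0 < s)%R%:R.

Section HOfDoubleWave.
Variables (fm fp : R -> R) (uL uR b : R) (w : R -> R).
Hypotheses (cfm : convex_flux fm) (cfp : convex_flux fp).
Hypothesis dw : double_waved fm fp uL uR b w.
Let M := max_speed fm fp uL uR.
Let h := hfun fm fp w.
Let sm := fastest_speed fm uL b.
Let sp := slowest_speed fp b uR.

Let monotone_segment_integrable g (c : R -> bool) : {homo g : x y / x <= y} ->
  measurable_fun setT (fun s => (c s)%:R : R) ->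
  segment_integrable (fun s => g (w s) * (c s)%:R).
Proof.
move=> mono mc; pose lo := Num.min uL uR; pose hi := Num.max uL uR.
apply: (@bounded_segment_integrable _ _ (`|g lo| + `|g hi|)).
  apply: measurable_funM => //; case: dw => -[] mw _ _ _ _.
    by apply: nondecreasing_measurable => // x y xy; exact/mono/mw.
  by apply: nonincreasing_measurable => // x y xy; exact/mono/mw.
move=> s; have /andP[/mono lo_s /mono s_hi] := double_waved_range cfm cfp dw s.
have := ler_norm (g hi); have := normr_ge0 (g hi).
have := ler_norm (- g lo); have := normr_ge0 (g lo); rewrite normrN.
case: (c s) => ? ? ? ?; rewrite ?mulr1 ?mulr0 ?normr0 ?addr_ge0//.
by rewrite ler_norml; apply/andP; split; rewrite -/lo -/hi in lo_s s_hi; lra.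
Qed.

Lemma double_waved_segment_integrable : segment_integrable w.
Proof.
have -> : w = (fun s => id (w s) * (true : bool)%:R).
  by apply/funext => s; rewrite mulr1.
exact: (monotone_segment_integrable (g := id) (c := fun=> true)).
Qed.

Lemma double_waved_slope_integrable :
  segment_integrable (limit_slope fm fp w).
Proof.
apply: segment_integrableB; first apply: segment_integrableB.
- by apply: continuous_segment_integrable => s; exact: cvg_id.
- apply: monotone_segment_integrable (convex_flux_derive1_le cfm) _.
  apply: nonincreasing_measurable => // x y xy; rewrite ler_nat.
  by case: (ltP y 0) => // /(le_lt_trans xy) ->.
- apply: monotone_segment_integrable (convex_flux_derive1_le cfp) _.
  apply: nondecreasing_measurable => // x y xy; rewrite ler_nat.
  by case: (ltP 0 x) => // /lt_le_trans/(_ xy) ->.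
Qed.

Lemma limit_slope_neg s : s < 0 -> limit_slope fm fp w s = s - fm^`() (w s).
Proof.
by move=> s0; rewrite /limit_slope s0 ltNge (ltW s0)/= mulr1 mulr0 subr0.
Qed.

Lemma limit_slope_pos s : 0 < s -> limit_slope fm fp w s = s - fp^`() (w s).
Proof.
by move=> s0; rewrite /limit_slope s0 ltNge (ltW s0)/= mulr1 mulr0 subr0.
Qed.

Lemma hfun0 : h 0 = 0.
Proof. exact: oriented_integral00. Qed.

Lemma hfun_left_parabola x : sm <= x <= 0 -> h x = 2^-1 * x ^+ 2 - fm^`() b * x.
Proof.
move=> /andP[sx x0]; have [_ _ wb _] := double_waved_left cfm dw.
have := oriented_integral_affine double_waved_slope_integrable x0.
move=> /(_ (fm^`() b)); rewrite -/(hfun fm fp w 0) -/(hfun fm fp w x) -/h hfun0.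
rewrite expr0n/= !sub0r.
have e s : x < s < 0 -> limit_slope fm fp w s = s - fm^`() b.
  by move=> /andP[xs s0]; rewrite limit_slope_neg// wb// s0 (le_lt_trans sx).
by move=> /(_ e); rewrite mulrN => /eqP; rewrite eqr_oppLR => /eqP ->; ring.
Qed.

Lemma hfun_right_parabola x : 0 <= x <= sp -> h x = 2^-1 * x ^+ 2 - fp^`() b * x.
Proof.
move=> /andP[x0 xs]; have [_ _ wb _] := double_waved_right cfp dw.
have := oriented_integral_affine double_waved_slope_integrable x0.
move=> /(_ (fp^`() b)); rewrite -/(hfun fm fp w 0) -/(hfun fm fp w x) -/h hfun0.
rewrite expr0n/= !subr0; apply => s /andP[s0 sx].
by rewrite limit_slope_pos// wb// s0 (lt_le_trans sx).
Qed.

Lemma hfun_left_min x : x <= 0 -> h sm <= h x.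
Proof.
move=> x0; have [sm0 bs wb left] := double_waved_left cfm dw.
have ik := double_waved_slope_integrable.
have [xs|sx] := leP x sm.
  apply: (oriented_integral_nonincreasing ik xs) => s /andP[_ ss].
  by rewrite -/(limit_slope _ _ _ _) limit_slope_neg ?(lt_trans ss)// subr_le0 left.
apply: (oriented_integral_nondecreasing ik (ltW sx)) => s /andP[ss sx'].
have s0 : s < 0 by apply: lt_le_trans x0.
rewrite -/(limit_slope _ _ _ _) limit_slope_neg// wb ?ss// subr_ge0.
by rewrite (le_trans bs)// ltW.
Qed.

Lemma hfun_right_min x : 0 <= x -> h sp <= h x.
Proof.
move=> x0; have [sp0 bs wb right] := double_waved_right cfp dw.
have ik := double_waved_slope_integrable.
have [sx|xs] := leP sp x.
  apply: (oriented_integral_nondecreasing ik sx) => s /andP[ss _].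
  by rewrite -/(limit_slope _ _ _ _) limit_slope_pos ?(lt_trans sp0)// subr_ge0 right.
apply: (oriented_integral_nonincreasing ik (ltW xs)) => s /andP[xs' ss].
have s0 : 0 < s by apply: le_lt_trans xs'.
rewrite -/(limit_slope _ _ _ _) limit_slope_pos// wb ?s0// subr_le0.
by rewrite (le_trans _ bs)// ltW.
Qed.

Let middle_speeds : - M <= fm^`() b /\ fp^`() b <= M.
Proof.
have bI : Num.min uL uR <= b <= Num.max uL uR.
  by have /andP[/ltW -> /ltW ->] := double_waved_between dw.
have := max_speed_ge cfm cfp bI; rewrite -/M => speed.
have := ler_norm (- fm^`() b); rewrite normrN; have := normr_ge0 (fp^`() b).
have := ler_norm (fp^`() b); have := normr_ge0 (fm^`() b).
by split; lra.
Qed.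

(** This bound keeps [h] close to its minimum on a segment whose length does not
    depend on the viscosity: the lower bound for a Laplace integral needs it. *)
Lemma hfun_left_near_min x : sm <= x <= 0 -> h x <= h sm + (x - sm) * M.
Proof.
move=> /andP[sx x0]; have [sm0 _ _ _] := double_waved_left cfm dw.
rewrite (hfun_left_parabola (x := x)) ?sx//.
rewrite (hfun_left_parabola (x := sm)); last by rewrite lexx ltW.
rewrite -lerBlDl.
rewrite (_ : _ - _ = (x - sm) * (2^-1 * (x + sm) - fm^`() b)); last by field.
rewrite ler_wpM2l ?subr_ge0//.
by have [? _] := middle_speeds; rewrite -/sm in sm0; lra.
Qed.

Lemma hfun_right_near_min x : 0 <= x <= sp -> h x <= h sp + (sp - x) * M.
Proof.
move=> /andP[x0 xs]; have [sp0 _ _ _] := double_waved_right cfp dw.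
rewrite (hfun_right_parabola (x := x)) ?x0//.
rewrite (hfun_right_parabola (x := sp)); last by rewrite lexx ltW.
rewrite -lerBlDl.
rewrite (_ : _ - _ = (sp - x) * (fp^`() b - 2^-1 * (x + sp))); last by field.
rewrite ler_wpM2l ?subr_ge0//.
by have [_ ?] := middle_speeds; rewrite -/sp in sp0; lra.
Qed.

(** The edges of the two waves are minimizers of [h], so the selection
    criterion compares two explicit values. *)
Lemma selection_criterionE :
  selection_criterion fm fp uL uR w <-> h sm = h sp.
Proof.
have [sm0 _ _ _] := double_waved_left cfm dw.
have [sp0 _ _ _] := double_waved_right cfp dw.
have smM := left_edge_ge cfm cfp dw; have spM := right_edge_le cfm cfp dw.
split=> [[m [[[x /andP[_ x0] hx] mL] [[y /andP[y0 _] hy] mR]]]|e].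
  transitivity m; apply/eqP; rewrite eq_le.
    by rewrite -{1}hx hfun_left_min//= mL// smM ltW.
  by rewrite -{2}hy hfun_right_min// mR// spM ltW.
exists (h sm); split; split.
- by exists sm => //; rewrite smM ltW.
- by move=> x /andP[_ x0]; exact: hfun_left_min.
- by exists sp => //; rewrite spM ltW.
- by move=> x /andP[x0 _]; rewrite e; exact: hfun_right_min.
Qed.

End HOfDoubleWave.

End SelectionFunctional.

(** * Uniqueness of the middle state *)

Section Uniqueness.
Context {R : realType}.
Implicit Types (f fm fp u w h : R -> R) (a b c uL uR x y z xi : R).

(** [2^-1 * s ^+ 2 - p * s] is the minimum of [h] on the side of a wave whose
    edge is [s] and whose middle state has speed [p].  The hypotheses are those
    of a left wave; reversing all signs turns a right wave into one, with the
    order of the two middle states reversed. *)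
Lemma parabola_min_lt (p p' s s' : R) : p <= s -> s < s' -> p < p' -> s' <= 0 ->
  2^-1 * s ^+ 2 - p * s < 2^-1 * s' ^+ 2 - p' * s'.
Proof. by move=> *; nra. Qed.

Lemma fastest_speed_lt f a b b' : convex_flux f ->
  b < b' -> a < b \/ b' < a -> fastest_speed f a b < fastest_speed f a b'.
Proof.
move=> cf bb' []; rewrite /fastest_speed.
  by move=> ab; rewrite ab (lt_trans ab bb') convex_flux_derive1_lt.
move=> b'a; rewrite [a < b']ltNge (ltW b'a) [a < b]ltNge (ltW (lt_trans bb' b'a))/=.
by apply: shock_speed_homo => //; left.
Qed.

Lemma slowest_speed_lt f b b' c : convex_flux f ->
  b < b' -> c < b \/ b' < c -> slowest_speed f b c < slowest_speed f b' c.
Proof.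
move=> cf bb' []; rewrite /slowest_speed; last first.
  by move=> b'c; rewrite b'c (lt_trans bb' b'c) convex_flux_derive1_lt.
move=> cb; rewrite [b < c]ltNge (ltW cb) [b' < c]ltNge (ltW (lt_trans cb bb'))/=.
rewrite ![shock_speed f _ c]shock_speedC.
by apply: shock_speed_homo => //; right.
Qed.

(** Moving the middle state up raises the left minimum and lowers the right
    one, so the two cannot agree at both states. *)
Lemma double_waved_selection_lt fm fp uL uR b b' w w' :
  convex_flux fm -> convex_flux fp -> b < b' ->
  double_waved fm fp uL uR b w -> double_waved fm fp uL uR b' w' ->
  selection_criterion fm fp uL uR w -> selection_criterion fm fp uL uR w' ->
  False.
Proof.
move=> cfm cfp bb' dw dw'.
move=> /(selection_criterionE cfm cfp dw) + /(selection_criterionE cfm cfp dw').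
have [sm0 bm _ _] := double_waved_left cfm dw.
have [sm0' bm' _ _] := double_waved_left cfm dw'.
have [sp0 bp _ _] := double_waved_right cfp dw.
have [sp0' bp' _ _] := double_waved_right cfp dw'.
rewrite (hfun_left_parabola cfm cfp dw) ?lexx ?ltW// (hfun_right_parabola cfm cfp dw) ?lexx ?ltW//.
rewrite (hfun_left_parabola cfm cfp dw') ?lexx ?ltW// (hfun_right_parabola cfm cfp dw') ?lexx ?ltW//.
have sides : (uL < b /\ b' < uR) \/ (b' < uL /\ uR < b).
  case: dw => _ + _ _ _; case: dw' => _ + _ _ _.
  case=> /andP[h1 h2] [] /andP[h3 h4]; try by [left|right].
    by have := lt_trans h1 (lt_trans h2 (lt_trans h3 h4)); rewrite ltxx.
  by have := lt_trans h1 (lt_trans h2 (lt_trans h3 h4)); rewrite ltxx.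
have ltm : fastest_speed fm uL b < fastest_speed fm uL b'.
  by apply: fastest_speed_lt => //; case: sides => -[]; [left|right].
have ltp : slowest_speed fp b uR < slowest_speed fp b' uR.
  by apply: slowest_speed_lt => //; case: sides => -[]; [right|left].
have := parabola_min_lt bm ltm (convex_flux_derive1_lt cfm bb') (ltW sm0').
have := @parabola_min_lt (- fp^`() b') (- fp^`() b) (- slowest_speed fp b' uR)
  (- slowest_speed fp b uR).
rewrite !lerN2 !ltrN2 !sqrrN !mulrNN oppr_le0.
move=> /(_ bp' ltp (convex_flux_derive1_lt cfp bb') (ltW sp0)).
by move=> ? ? ? ?; lra.
Qed.

(** By the Lax condition, or at the end of a fan, [fm' b] and [fp' b] are at
    least as far from [0] as the wave edges, so they are negative and
    positive. *)
Lemma double_waved_sonic fm fp usm usp uL uR b w :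
  convex_flux fm -> convex_flux fp ->
  is_sonic_point fm usm -> is_sonic_point fp usp ->
  double_waved fm fp uL uR b w -> (usp < b%:E < usm)%E.
Proof.
move=> cfm cfp sm sp dw.
have [sm0 bm _ _] := double_waved_left cfm dw.
have [sp0 bp _ _] := double_waved_right cfp dw.
have bm0 : fm^`() b < 0 by exact: le_lt_trans sm0.
have bp0 : 0 < fp^`() b by exact: lt_le_trans bp.
apply/andP; split.
- case: usp sp => [r| |] /=; last by rewrite ltNyr.
    move=> r0; rewrite lte_fin ltNge; apply/negP => /(convex_flux_derive1_le cfp).
    by rewrite r0 leNgt bp0.
  by move=> /(_ b)/(lt_trans bp0); rewrite ltxx.
- case: usm sm => [r| |] /=; last 2 first.
  + by rewrite ltry.
  + by move=> /(_ b)/lt_trans/(_ bm0); rewrite ltxx.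
  move=> r0; rewrite lte_fin ltNge; apply/negP => /(convex_flux_derive1_le cfm).
  by rewrite r0 leNgt bm0.
Qed.
End Uniqueness.

(** * Profiles with exponential derivative *)

Section ExponentialProfiles.
Context {R : realType}.
Implicit Types (y p k F : R -> R) (a b c d e x : R).

(** The derivative is a Gibbs density of energy [F] at temperature [e].  Both
    [u] and [v] have this form in a viscous solution, [v] with a quadratic
    energy. *)
Definition exponential_profile a b e F c y :=
  {within `[a, b], continuous y} /\
  forall x, a < x < b -> is_derive x 1 y (c * expR (- F x / e)).

Lemma derive0_constant a b q :
  (forall x, a < x < b -> is_derive x (1 : R) q (0 : R)) ->
  forall x x', a < x < b -> a < x' < b -> q x = q x' :> R.
Proof.
move=> dq x x'; wlog xx' : x x' / x <= x' => [hw xI xI'|/andP[ax xb] /andP[ax' xb']].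
  by have [/hw|/ltW/hw h] := leP x x'; [apply|apply/esym/h].
have dq' z : z \in `]x, x'[%R -> is_derive z (1 : R) q (cst 0 z : R).
  by rewrite in_itv/= => /andP[xz zx']; apply: dq; rewrite (lt_trans ax)//= (lt_trans zx').
have [|z _] := @MVT_segment _ q (cst 0) x x' xx' dq'.
  apply: derivable_within_continuous => z; rewrite in_itv/= => /andP[xz zx'].
  have : is_derive z (1 : R) q (0 : R) by apply: dq; rewrite (lt_le_trans ax)//= (le_lt_trans zx').
  by case.
by rewrite /cst mul0r => /eqP; rewrite subr_eq0 => /eqP.
Qed.

(** [p * exp (F / e)] has derivative zero. *)
Lemma linear_ode_exponential a b e k F p : e != 0 -> a < b ->
  (forall x, a < x < b -> is_derive x 1 F (k x)) ->
  (forall x, a < x < b -> derivable p x 1 /\ e * p^`() x = - k x * p x) ->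
  exists c, forall x, a < x < b -> p x = c * expR (- F x / e).
Proof.
move=> e0 ab dF dp.
pose q x := p x * expR (e^-1 * F x).
have dq x : a < x < b -> is_derive x (1 : R) q (0 : R).
  move=> xI; have dFx := dF x xI; have [dpx ep] := dp x xI.
  have dpx' : is_derive x 1 p (p^`() x).
    by rewrite derive1E; exact/derivableP.
  have dE : is_derive x (1 : R) (fun x => expR (e^-1 * F x)) (expR (e^-1 * F x) * (e^-1 * k x)).
    by apply: (@is_derive1_comp _ expR (fun x => e^-1 * F x)).
  apply: (is_derive_eq (is_deriveM dpx' dE)).
  rewrite -![_ *: _]/(_ * _).
  have -> : p^`() x = - k x * p x / e by rewrite -ep mulrAC mulfV ?mul1r.
  by field.
pose x0 := 2^-1 * (a + b).
have x0I : a < x0 < b by rewrite /x0; apply/andP; split; lra.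
exists (q x0) => x xI; rewrite (derive0_constant dq x0I xI) /q -mulrA -expRD.
by rewrite mulNr [F x / e]mulrC addrN expR0 mulr1.
Qed.

Section Profile.
Variables (a b e c : R) (F y : R -> R).
Hypothesis prof : exponential_profile a b e F c y.

Lemma exponential_profile_mvt x x' : a <= x -> x < x' -> x' <= b ->
  exists2 z, x < z < x' & y x' - y x = c * (expR (- F z / e) * (x' - x)).
Proof.
case: prof => cy dy ax xx' x'b.
have [z||z] := @MVT _ y (fun z => c * expR (- F z / e)) x x' xx'.
- rewrite in_itv/= => /andP[xz zx']; apply: dy.
  by rewrite (le_lt_trans ax)//= (lt_le_trans zx').
- by apply: continuous_subspaceW cy; apply: subset_itv; rewrite bnd_simp.
- by rewrite in_itv/= => zI ->; exists z => //; rewrite mulrA.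
Qed.

Lemma exponential_profile_increment x x' : a <= x -> x <= x' -> x' <= b ->
  exists2 g, 0 <= g & y x' - y x = c * g.
Proof.
move=> ax; rewrite le_eqVlt => /predU1P[<- _|xx' x'b].
  by exists 0 => //; rewrite subrr mulr0.
have [z _ ->] := exponential_profile_mvt ax xx' x'b.
by eexists; last reflexivity; rewrite mulr_ge0 ?expR_ge0// subr_ge0 ltW.
Qed.

(** The Laplace comparison.  The increment over [[A, B]] is at least the one
    over [[x, x']], where the density is at least [exp (- K / e)], while over
    [[C, D]] the density is at most [exp (- (K + eta) / e)].  The unknown
    constant [c] multiplies both increments and drops out. *)
Lemma exponential_profile_balance A B C D x x' K eta :
  0 < e -> a <= A -> A <= x -> x < x' -> x' <= B -> B <= b ->
  a <= C -> C < D -> D <= b ->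
  (forall z, x < z < x' -> F z <= K) ->
  (forall z, C < z < D -> K + eta <= F z) ->
  `|y D - y C| * (x' - x) <= `|y B - y A| * (D - C) * expR (- eta / e).
Proof.
move=> e0 aA Ax xx' x'B Bb aC CD Db FK KF.
have ax := le_trans aA Ax; have x'b := le_trans x'B Bb.
have [g1 g10 e1] := exponential_profile_increment aA Ax (le_trans (ltW xx') x'b).
have [g3 g30 e3] := exponential_profile_increment (le_trans ax (ltW xx')) x'B Bb.
have [z2 /FK z2K e2] := exponential_profile_mvt ax xx' x'b.
have [z4 /KF z4K e4] := exponential_profile_mvt aC CD Db.
set g2 := expR _ * _ in e2; set g4 := expR _ * _ in e4.
have -> : y B - y A = c * (g1 + g2 + g3).
  by rewrite !mulrDr -e1 -e2 -e3; ring.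
have g20 : 0 <= g2 by rewrite mulr_ge0 ?expR_ge0// subr_ge0 ltW.
have g40 : 0 <= g4 by rewrite mulr_ge0 ?expR_ge0// subr_ge0 ltW.
rewrite e4 (normrM c g4) (normrM c (_ + _)) (ger0_norm g40) (ger0_norm (_ : 0 <= g1 + g2 + g3)) ?addr_ge0//.
rewrite -[leLHS]mulrA -[leRHS]mulrA -[leRHS]mulrA ler_wpM2l//.
apply: (@le_trans _ _ (g2 * ((D - C) * expR (- eta / e)))); last first.
  rewrite ler_wpM2r//; last by lra.
  by rewrite mulr_ge0 ?expR_ge0// subr_ge0 ltW.
rewrite /g2 /g4.
rewrite [leLHS](_ : _ = (D - C) * (x' - x) * expR (- F z4 / e)); last by ring.
rewrite [leRHS](_ : _ = (D - C) * (x' - x) * (expR (- F z2 / e) * expR (- eta / e))); last by ring.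
rewrite ler_wpM2l//; first by rewrite mulr_ge0// subr_ge0 ltW.
by rewrite -expRD ler_expR -mulrDl ler_pM2r ?invr_gt0//; lra.
Qed.

(** Every increment has the sign of [c]. *)
Lemma exponential_profile_monotone x x' : a <= x -> x <= x' -> x' <= b ->
  0 <= (y b - y a) * (y x' - y x).
Proof.
move=> ax xx' x'b.
have ab : a <= b by apply: le_trans ax _; apply: le_trans x'b.
have [g g0 ->] := exponential_profile_increment ax xx' x'b.
have [g' g'0 ->] := exponential_profile_increment (lexx a) ab (lexx b).
rewrite mulrACA; apply: mulr_ge0; last exact: mulr_ge0.
by rewrite -expr2 sqr_ge0.
Qed.

End Profile.

(** The Gaussian density [E] satisfies [e * E' = - x * E], so the function
    [d * y + e * c * E] is nonincreasing on [[d, b]]; this bounds the tail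
    [y b - y d] by [e * c * E d / d].  As [E] decreases on [[0, d]],
    [c * E d] is in turn at most [(y d - y 0) / d]. *)
Lemma gaussian_profile_tail b e c y d : 0 < e -> 0 <= c ->
  exponential_profile 0 b e (fun x => 2^-1 * x ^+ 2) c y ->
  0 < d -> d <= b -> d ^+ 2 * (y b - y d) <= e * (y d - y 0).
Proof.
move=> e0 c0 prof d0 db; have [cy dy] := prof.
pose E (x : R) := expR (- (2^-1 * x ^+ 2) / e).
have first_half : d * (c * E d) <= y d - y 0.
  have [z /andP[z0 zd] ->] := exponential_profile_mvt prof (lexx 0) d0 db.
  rewrite subr0 mulrCA ler_wpM2l// mulrC ler_wpM2r ?(ltW d0)//.
  rewrite ler_expR ler_pM2r ?invr_gt0// lerN2 ler_pM2l//.
  by rewrite ler_sqr ?nnegrE; exact: ltW.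
pose g (x : R) := d * y x + e * (c * E x).
have dE (x : R) : is_derive x 1 E (E x * (- x / e)).
  have dq : is_derive x (1 : R) (fun x : R => - (2^-1 * x ^+ 2) / e) (- x / e).
    apply: is_derive_eq; rewrite -![_ *: _]/(_ * _) /=; field.
    by rewrite gt_eqF.
  exact: (@is_derive1_comp _ expR).
have dg (x : R) : x \in `]d, b[%R -> is_derive x 1 g (c * E x * (d - x)).
  rewrite in_itv/= => /andP[dx xb].
  have dyx : is_derive x 1 y (c * E x) by apply: dy; rewrite xb (lt_trans d0).
  have dEx := dE x.
  rewrite /g; apply: is_derive_eq; rewrite -![_ *: _]/(_ * _) /=; field.
  by rewrite gt_eqF.
have cg : {within `[d, b], continuous g}.
  have cE : continuous E.
    by move=> x; apply/differentiable_continuous/derivable1_diffP; case: (dE x).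
  have cyd : {within `[d, b], continuous y}.
    by apply: continuous_subspaceW cy; apply: subset_itv; rewrite bnd_simp// ltW.
  move=> x; apply: cvgD; first by apply: cvgM; [exact: cvg_cst|exact: cyd].
  apply: cvgM; first exact: cvg_cst.
  apply: cvgM; first exact: cvg_cst.
  by apply: continuous_subspaceT cE x.
have [z] := MVT_segment db dg cg; rewrite in_itv/= => /andP[dz zb] eg.
have : g b <= g d.
  rewrite -subr_le0 eg mulr_le0_ge0 ?subr_ge0// mulr_ge0_le0 ?subr_le0//.
  by rewrite mulr_ge0// expR_ge0.
rewrite /g => gbd.
have cEb : 0 <= e * (c * E b) by rewrite !mulr_ge0 ?expR_ge0// ltW.
have h1 : d * (y b - y d) <= e * (c * E d) by lra.
rewrite expr2 -mulrA (le_trans (_ : _ <= d * (e * (c * E d))))//.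
  by rewrite ler_wpM2l// ltW.
by rewrite mulrCA ler_wpM2l// ltW.
Qed.

End ExponentialProfiles.

(** * Continuity, primitives and the heat profile *)

Section Viscous.
Context {R : realType}.
Local Notation mu := (@lebesgue_measure R).
Implicit Types (y p k F : R -> R) (a b c d e x : R).

(** Extending the profiles by their boundary values gives functions continuous
    on the whole line, which spares one-sided arguments at the two ends. *)
Lemma continuous_constant_outside a b y : a <= b ->
  {within `[a, b], continuous y} ->
  (forall x, x <= a -> y x = y a) -> (forall x, b <= x -> y x = y b) ->
  continuous y.
Proof.
move=> ab cy ya yb.
have : {within `]-oo, a] `|` (`[a, b] `|` `[b, +oo[), continuous y}.
  apply: withinU_continuous.
  - exact: interval_closed.
  - by apply: closedU; exact: interval_closed.
  - apply: (subspace_eq_continuous (f := cst (y a))).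
      by move=> x; rewrite inE/= in_itv/= => /ya.
    by apply: continuous_subspaceT; exact: cst_continuous.
  apply: withinU_continuous; [exact: interval_closed|exact: interval_closed|exact: cy|].
  apply: (subspace_eq_continuous (f := cst (y b))).
    by move=> x; rewrite inE/= in_itv/= andbT => /yb.
  by apply: continuous_subspaceT; exact: cst_continuous.
rewrite (_ : _ `|` _ = setT); last first.
  apply/seteqP; split=> // x _ /=; rewrite !in_itv/= andbT.
  have [xa|ax] := leP x a; first by left.
  right; have [xb|bx] := leP x b; last by right; exact: ltW.
  by left; rewrite (ltW ax).
by rewrite -continuous_subspace_setT.
Qed.

Lemma continuous_primitive k a b : a < b -> continuous k ->
  exists F, (forall x, a < x < b -> is_derive x 1 F (k x)) /\
    forall x x', a <= x -> x <= x' -> x' <= b ->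
      F x' - F x = (\int[mu]_(s in `[x, x']) k s)%R.
Proof.
move=> ab ck; have ik := continuous_segment_integrable ck.
exists (fun x => (\int[mu]_(s in `[a, x]) k s)%R); split.
  move=> x /andP[ax xb].
  have [dF F'] := continuous_FTC1_closed xb (ik a b) ax (ck x).
  by rewrite derive1E in F'; exact: (DeriveDef dF F').
move=> x x' ax xx' _; rewrite (Rintegral_itv_chasles ik ax xx').
by rewrite addrAC subrr add0r.
Qed.

(** The tail bound of [gaussian_profile_tail] applied to [v], and on the left to
    its reflection [- v (- x)], whose derivative is the same Gaussian. *)
Lemma heat_profile_bounds M e v c : 0 < M -> 0 < e -> continuous v ->
  exponential_profile (- M) M e (fun x => 2^-1 * x ^+ 2) c v ->
  v (- M) = -1 -> v M = 1 ->
  [/\ forall x, - M <= x <= M -> -1 <= v x <= 1,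
      forall d x, 0 < d -> d <= x <= M -> 1 - v x <= 2 * e / d ^+ 2
    & forall d x, 0 < d -> - M <= x <= - d -> 1 + v x <= 2 * e / d ^+ 2].
Proof.
move=> M0 e0 gcv prof vm vp.
have MM : - M <= M by lra.
have [cv dv] := prof.
have c0 : 0 <= c.
  have [g g0] := exponential_profile_increment prof (lexx _) MM (lexx _).
  rewrite vm vp => e2; have {}e2 : c * g = 2 by lra.
  rewrite leNgt; apply/negP => c0.
  by have := mulr_le0_ge0 (ltW c0) g0; rewrite e2; lra.
have vI x : - M <= x <= M -> -1 <= v x <= 1.
  move=> /andP[Mx xM].
  have [g g0 eg] := exponential_profile_increment prof (lexx _) Mx xM.
  have [g' g'0 eg'] := exponential_profile_increment prof Mx xM (lexx _).
  rewrite vm in eg; rewrite vp in eg'.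
  by rewrite -[_ <= v x]subr_ge0 -[v x <= _]subr_ge0 eg eg' !mulr_ge0.
have tail y d x : 0 < d -> d <= x <= M -> y M = 1 -> -1 <= y 0 -> y x <= 1 ->
    exponential_profile 0 M e (fun x => 2^-1 * x ^+ 2) c y ->
    1 - y x <= 2 * e / d ^+ 2.
  move=> d0 /andP[dx xM] yM y0 yx prof_y.
  have x0 := lt_le_trans d0 dx.
  have := gaussian_profile_tail e0 c0 prof_y x0 xM; rewrite yM => h.
  rewrite ler_pdivlMr ?exprn_gt0// mulrC.
  have h1 : d ^+ 2 * (1 - y x) <= x ^+ 2 * (1 - y x).
    by rewrite ler_wpM2r ?subr_ge0// ler_sqr ?nnegrE// ltW.
  have h2 : e * (y x - y 0) <= e * 2 by rewrite ler_wpM2l ?(ltW e0)//; lra.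
  by lra.
have v0I : -1 <= v 0 <= 1 by apply: vI; lra.
split=> // d x d0 /andP[h1 h2].
  have /andP[vx1 vx2] : -1 <= v x <= 1 by apply: vI; rewrite h2 andbT; lra.
  apply: (tail v) => //; first by rewrite h1.
    by case/andP: v0I.
  split; first by apply: continuous_subspaceW cv; apply: subset_itv; rewrite bnd_simp//; lra.
  by move=> z /andP[z0 zM]; apply: dv; rewrite zM andbT; lra.
have /andP[vx1 vx2] : -1 <= v x <= 1 by apply: vI; rewrite h1; lra.
rewrite -[v x]opprK -[x in v x]opprK.
apply: (tail (fun z => - v (- z))) => //; rewrite ?opprK ?vm ?opprK ?oppr0//.
- by apply/andP; split; lra.
- by case/andP: v0I; lra.
- by lra.
split.
  apply: continuous_subspaceT => z; apply: continuousN.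
  by apply: continuous_comp; [exact: opp_continuous|exact: gcv].
move=> z /andP[z0 zM].
have dvz : is_derive (- z) (1 : R) v (c * expR (- (2^-1 * z ^+ 2) / e)).
  by rewrite -(sqrrN z); apply: dv; apply/andP; split; lra.
have dN : is_derive z (1 : R) (fun z : R => - z) (-1).
  by apply: is_derive_eq.
apply: (is_derive_eq (is_deriveN (is_derive1_comp dvz dN))).
by rewrite mulrN1 opprK.
Qed.
End Viscous.

(** * Viscous profiles *)

Section Dafermos.
Context {R : realType}.
Local Notation mu := (@lebesgue_measure R).
Implicit Types (f fm fp u v w k F : R -> R) (a b c d e x y : R).

(** The profiles converge in [L^1], and a Lipschitz bound turns this into
    convergence of the speeds in [L^1]. *)
Lemma twice_cont_diff_lipschitz f a b : twice_cont_diff f -> a <= b ->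
  exists2 L, 0 <= L & forall x y, a <= x <= b -> a <= y <= b ->
    `|f^`() x - f^`() y| <= L * `|x - y|.
Proof.
move=> [_ df' cf''] ab.
have cn : continuous (fun x => `|f^`(2) x|).
  by move=> x; apply: continuous_comp; [exact: cf''|exact: norm_continuous].
have [z _ zmax] := EVT_max ab (continuous_subspaceT cn).
exists `|f^`(2) z| => // x y.
wlog xy : x y / x <= y => [hw xI yI|/andP[ax _] /andP[_ yb]].
  have [/hw|/ltW/hw h] := leP x y; first exact.
  by rewrite distrC [`|x - y|]distrC; exact: h.
have dfz t : is_derive t (1 : R) f^`() (f^`(2) t).
  by apply: DeriveDef; [exact: df'|rewrite /derive1n/= derive1E].
have [|t tI e] := @MVT_segment _ f^`() f^`(2) x y xy (fun t _ => dfz t).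
  apply: derivable_within_continuous => t _; exact: df'.
have -> : f^`() x - f^`() y = - (f^`(2) t * (y - x)) by rewrite -e opprB.
rewrite normrN (normrM (f^`(2) t)).
rewrite (distrC y).
apply: ler_wpM2r; first exact: normr_ge0.
apply: zmax.
by move: tI; rewrite !in_itv/= => /andP[xt ty]; rewrite (le_trans ax)//= (le_trans ty).
Qed.

Lemma twice_cont_diff_continuous f : twice_cont_diff f -> continuous f^`().
Proof.
by move=> [_ df' _] x; apply/differentiable_continuous/derivable1_diffP/df'.
Qed.

(** The derivative of the energy of a viscous profile; [limit_slope] is its
    limit when [v] tends to the sign of [s]. *)
Definition viscous_slope fm fp u v (s : R) : R :=
  s - 2^-1 * ((1 - v s) * fm^`() (u s) + (1 + v s) * fp^`() (u s)).

Section Profile.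
Variables (fm fp : R -> R) (uL uR : R).
Let M := max_speed fm fp uL uR.
Hypotheses (fm_C2 : twice_cont_diff fm) (fp_C2 : twice_cont_diff fp).
Hypothesis M0 : 0 < M.
Variables (e : R) (u v : R -> R).
Hypothesis e0 : 0 < e.
Hypothesis sol : dafermos_solution fm fp uL uR e u v.

Lemma dafermos_ends : [/\ u (- M) = uL, u M = uR, v (- M) = -1 & v M = 1].
Proof.
case: sol; rewrite -/M => left right _ _ _.
by have [] := left _ (lexx _); have [] := right _ (lexx _).
Qed.

Lemma dafermos_continuous : continuous u /\ continuous v.
Proof.
have [uLe uRe vLe vRe] := dafermos_ends.
case: sol; rewrite -/M => left right cu cv _.
have MM : - M <= M by rewrite (@le_trans _ _ 0)// ?oppr_le0 ltW.
split; apply: (continuous_constant_outside MM) => // x xM.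
- by rewrite (left _ xM).1.
- by rewrite (right _ xM).1.
- by rewrite (left _ xM).2.
- by rewrite (right _ xM).2.
Qed.

Lemma viscous_slope_continuous : continuous (viscous_slope fm fp u v).
Proof.
have [cu cv] := dafermos_continuous.
have cf f : twice_cont_diff f -> continuous (fun s => f^`() (u s)).
  move=> f_C2 s; apply: (@continuous_comp _ _ _ u f^`()); first exact: cu.
  exact: twice_cont_diff_continuous.
move=> s; apply: cvgB; first exact: cvg_id.
apply: cvgM; first exact: cvg_cst.
apply: cvgD; apply: cvgM.
- by apply: cvgB; [exact: cvg_cst|exact: cv].
- exact: cf.
- by apply: cvgD; [exact: cvg_cst|exact: cv].
- exact: cf.
Qed.

Lemma dafermos_exponential_profile : exists F c,
  exponential_profile (- M) M e F c u /\
  forall x x', - M <= x -> x <= x' -> x' <= M ->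
      F x' - F x = (\int[mu]_(s in `[x, x']) viscous_slope fm fp u v s)%R.
Proof.
case: sol; rewrite -/M => _ _ cu _ eqs.
have MM : - M < M by rewrite (@lt_trans _ _ 0)// oppr_lt0.
have [F [dF intF]] := continuous_primitive MM viscous_slope_continuous.
have [||c pc] := linear_ode_exponential (p := u^`()) _ MM dF (e := e).
- by rewrite gt_eqF.
- move=> x xI; have [[_ du'] _ eq_u _] := eqs x xI; split=> //.
  rewrite -[(u^`())^`() x]/(u^`(2) x) -eq_u /viscous_slope; ring.
exists F, c; split=> //; split=> // x xI.
have [[du _] _ _ _] := eqs x xI.
by apply: (DeriveDef du); rewrite -derive1E pc.
Qed.

Lemma dafermos_v_bounds :
  [/\ forall x, - M <= x <= M -> -1 <= v x <= 1,
      forall d x, 0 < d -> d <= x <= M -> 1 - v x <= 2 * e ^+ 2 / d ^+ 2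
    & forall d x, 0 < d -> - M <= x <= - d -> 1 + v x <= 2 * e ^+ 2 / d ^+ 2].
Proof.
have [_ _ vm vp] := dafermos_ends; have [_ gcv] := dafermos_continuous.
case: sol; rewrite -/M => _ _ _ cv eqs.
have MM : - M < M by rewrite (@lt_trans _ _ 0)// oppr_lt0.
have dF x : - M < x < M -> is_derive x (1 : R) (fun x : R => 2^-1 * x ^+ 2) x.
  by move=> _; apply: is_derive_eq; rewrite -![_ *: _]/(_ * _) /=; field.
have [||c pc] := linear_ode_exponential (p := v^`()) _ MM dF (e := e ^+ 2).
- by rewrite expf_eq0/= gt_eqF.
- move=> x xI; have [_ [_ dv'] _ eq_v] := eqs x xI; split=> //.
apply: (heat_profile_bounds (c := c)) => //; first by rewrite exprn_gt0.
split=> // x xI; have [_ [dv _] _ _] := eqs x xI.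
by apply: (DeriveDef dv); rewrite -derive1E pc.
Qed.

End Profile.
End Dafermos.

(** * Distance from the viscous exponent to h *)

Section Approximation.
Context {R : realType}.
Local Notation mu := (@lebesgue_measure R).
Implicit Types (f fm fp u v w k F : R -> R) (a b c d e x y : R).

(** [t] stands for the distance from [v] to its limit, [-1] or [1]; the flux of
    the wrong side of the interface has weight [t / 2] in the blend. *)
Lemma blended_speed_gap (L A B A' t M r : R) :
  `|A - A'| <= L -> `|A| + `|B| <= M -> 0 <= t <= 2 -> t <= 2 * r ->
  `|2^-1 * ((2 - t) * A + t * B) - A'| <= L + M * r.
Proof.
move=> AA' ABM /andP[t0 t2] tr.
have -> : 2^-1 * ((2 - t) * A + t * B) - A' = (A - A') + 2^-1 * t * (B - A).
  by field.
apply: le_trans (ler_normD _ _) _; apply: lerD => //.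
rewrite normrM (ger0_norm (_ : 0 <= 2^-1 * t)) ?mulr_ge0// mulrC.
apply: ler_pM; rewrite ?mulr_ge0//; last by lra.
by apply: le_trans (ler_normB _ _) _; rewrite addrC.
Qed.

Section Distance.
Variables (fm fp : R -> R) (uL uR b : R) (w : R -> R).
Let M := max_speed fm fp uL uR.
Let lo := Num.min uL uR.
Let hi := Num.max uL uR.
Hypotheses (fm_C2 : twice_cont_diff fm) (fp_C2 : twice_cont_diff fp).
Hypotheses (cfm : convex_flux fm) (cfp : convex_flux fp).
Hypothesis dw : double_waved fm fp uL uR b w.

Let M0 : 0 < M.
Proof. exact: max_speed_gt0 (double_waved_neq dw). Qed.

Let MM : - M <= M.
Proof. by rewrite (@le_trans _ _ 0)// ?oppr_le0 ltW. Qed.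

Lemma flux_lipschitz : exists2 L, 0 <= L &
  forall x y, lo <= x <= hi -> lo <= y <= hi ->
    `|fm^`() x - fm^`() y| <= L * `|x - y| /\
    `|fp^`() x - fp^`() y| <= L * `|x - y|.
Proof.
have lohi : lo <= hi by rewrite /lo /hi ge_min !le_max lexx.
have [Lm Lm0 hm] := twice_cont_diff_lipschitz fm_C2 lohi.
have [Lp Lp0 hp] := twice_cont_diff_lipschitz fp_C2 lohi.
exists (Lm + Lp) => [|x y xI yI]; first exact: addr_ge0.
rewrite mulrDl; split.
  by apply: (le_trans (hm x y xI yI)); rewrite lerDl mulr_ge0.
by apply: (le_trans (hp x y xI yI)); rewrite lerDr mulr_ge0.
Qed.

Section OneViscosity.
Variables (L : R).
Hypothesis L0 : 0 <= L.
Hypothesis Llip : forall x y, lo <= x <= hi -> lo <= y <= hi ->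
    `|fm^`() x - fm^`() y| <= L * `|x - y| /\
    `|fp^`() x - fp^`() y| <= L * `|x - y|.
Variables (e : R) (u v : R -> R).
Hypothesis e0 : 0 < e.
Hypothesis sol : dafermos_solution fm fp uL uR e u v.

Lemma dafermos_monotone x x' : - M <= x -> x <= x' -> x' <= M ->
  0 <= (uR - uL) * (u x' - u x).
Proof.
move=> Mx xx' x'M; have [F [c [prof _]]] := dafermos_exponential_profile fm_C2 fp_C2 M0 e0 sol.
have [uLe uRe _ _] := dafermos_ends sol.
by have := exponential_profile_monotone prof Mx xx' x'M; rewrite uLe uRe.
Qed.

Lemma dafermos_range x : - M <= x <= M -> lo <= u x <= hi.
Proof.
move=> /andP[Mx xM]; have [uLe uRe _ _] := dafermos_ends sol.
have := dafermos_monotone (lexx _) Mx xM; have := dafermos_monotone Mx xM (lexx _).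
rewrite uLe uRe /lo /hi ge_min le_max.
have [LR|RL|LR] := ltgtP uL uR; last by have := double_waved_neq dw; rewrite LR eqxx.
  by rewrite !pmulr_rge0 ?subr_gt0// !subr_ge0 => -> ->; rewrite orbT.
by rewrite !nmulr_rge0 ?subr_lt0// !subr_le0 => -> ->; rewrite orbT.
Qed.

(** Near the interface, where [v] is not yet close to its limit, the crude bound
    [M] is used on a set of measure [2 * d]; the indicator keeps track of it. *)
Lemma slope_gap d s : 0 < d -> - M < s < M ->
  `|viscous_slope fm fp u v s - limit_slope fm fp w s| <=
  L * `|u s - w s| + M * (\1_`[- d, d] s + e ^+ 2 / d ^+ 2).
Proof.
move=> d0 /andP[Ms sM].
have sI : - M <= s <= M by rewrite !ltW.
have uI := dafermos_range sI.
have wI := double_waved_range cfm cfp dw s.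
have speed := max_speed_ge cfm cfp uI; rewrite -/M in speed.
have [lipm lipp] := Llip uI wI.
have [vI vp vm] := dafermos_v_bounds M0 e0 sol.
have /andP[v1 v2] := vI s sI.
have ed0 : 0 <= e ^+ 2 / d ^+ 2 by rewrite divr_ge0// sqr_ge0.
have ind (t : R) : t <= 2 -> (s \notin `[- d, d]%R -> t <= 2 * e ^+ 2 / d ^+ 2) ->
    t <= 2 * (\1_`[- d, d] s + e ^+ 2 / d ^+ 2).
  move=> t2; rewrite indicE mem_setE; case: (s \in _) => /= [_|/(_ isT)]; by lra.
rewrite distrC; have [s0|s0|s0] := ltgtP s 0.
- rewrite limit_slope_neg// /viscous_slope.
  rewrite [X in `|X| <= _](_ : _ = 2^-1 * ((2 - (1 + v s)) * fm^`() (u s) +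
      (1 + v s) * fp^`() (u s)) - fm^`() (w s)); last by ring.
  apply: blended_speed_gap => //; first by lra.
  apply: ind => [|sd]; first by lra.
  apply: vm => //; rewrite (ltW Ms)/= leNgt; apply/negP => ds.
  by move: sd; rewrite in_itv/= (ltW ds)/= (le_trans (ltW s0) (ltW d0)).
- rewrite limit_slope_pos// /viscous_slope.
  rewrite [X in `|X| <= _](_ : _ = 2^-1 * ((2 - (1 - v s)) * fp^`() (u s) +
      (1 - v s) * fm^`() (u s)) - fp^`() (w s)); last by ring.
  apply: blended_speed_gap => //; [by rewrite addrC|by lra|].
  apply: ind => [|sd]; first by lra.
  apply: vp => //; rewrite (ltW sM) andbT leNgt; apply/negP => ds.
  by move: sd; rewrite in_itv/= (ltW ds) andbT (le_trans _ (ltW s0))// oppr_le0 ltW.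
- rewrite s0 in v1 v2 speed *.
  rewrite (_ : limit_slope fm fp w 0 - _ =
      2^-1 * ((1 - v 0) * fm^`() (u 0) + (1 + v 0) * fp^`() (u 0))); last first.
    by rewrite /limit_slope /viscous_slope ltxx !mulr0; ring.
  have -> : (\1_`[- d, d] (0 : R) : R) = 1.
    by rewrite indicE mem_set//= in_itv/= oppr_le0 !ltW.
  have hM : `|2^-1 * ((1 - v 0) * fm^`() (u 0) + (1 + v 0) * fp^`() (u 0))| <= M.
    rewrite normrM gtr0_norm// mulrC ler_pdivrMr//.
    apply: le_trans (ler_normD _ _) _.
    rewrite (normrM (1 - v 0)) (normrM (1 + v 0)).
    rewrite (ger0_norm (_ : 0 <= 1 - v 0)); last by lra.
    rewrite (ger0_norm (_ : 0 <= 1 + v 0)); last by lra.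
    have a0 := normr_ge0 (fm^`() (u 0)); have b0 := normr_ge0 (fp^`() (u 0)).
    by nra.
  apply: (le_trans hM); rewrite mulrDr mulr1.
  have h1 := mulr_ge0 L0 (normr_ge0 (u 0 - w 0)).
  have h2 := mulr_ge0 (ltW M0) ed0.
  by lra.
Qed.

Lemma dafermos_gap_integrable : segment_integrable (fun s => `|u s - w s|).
Proof.
apply: segment_integrable_norm; apply: segment_integrableB.
  by apply: continuous_segment_integrable; case: (dafermos_continuous M0 sol).
exact: double_waved_segment_integrable cfm cfp dw.
Qed.

Let gap d s : R := L * `|u s - w s| + M * (\1_`[- d, d] s + e ^+ 2 / d ^+ 2).

Let gap_integrable d : segment_integrable (gap d).
Proof.
apply: segment_integrableD.
  by apply: segment_integrableZ; exact: dafermos_gap_integrable.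
apply: segment_integrableZ; apply: segment_integrableD.
  exact: segment_integrable_indic.
by apply: continuous_segment_integrable; exact: cst_continuous.
Qed.

Let Rintegral_gap d : 0 < d -> d <= M ->
  (\int[mu]_(s in `[- M, M]) gap d s = L * \int[mu]_(s in `[- M, M]) `|u s - w s| +
    M * (2 * d + e ^+ 2 / d ^+ 2 * (2 * M)))%R.
Proof.
move=> d0 dM; have ig := dafermos_gap_integrable.
have ii := @segment_integrable_indic R (- d) d.
have ic : segment_integrable (fun _ : R => e ^+ 2 / d ^+ 2).
  by apply: continuous_segment_integrable; exact: cst_continuous.
have iic := segment_integrableD ii ic.
have iL := segment_integrableZ L ig; have iM := segment_integrableZ M iic.
rewrite /gap (RintegralD _ (iL (- M) M) (iM (- M) M))//.
rewrite (RintegralZl L _ (ig (- M) M))//.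
rewrite (RintegralZl M _ (iic (- M) M))//.
rewrite (RintegralD _ (ii (- M) M) (ic (- M) M))//.
rewrite (Rintegral_itv_indic (ltW d0) dM).
have -> := Rintegral_itv_cst (e ^+ 2 / d ^+ 2) MM.
by congr (_ + _ * (_ + _ * _)); ring.
Qed.

(** Choosing first [d] small, then [e] small compared with [d], then the
    profiles close in [L^1], makes the right-hand side arbitrarily small. *)
Lemma primitive_gap F d x : 0 < d -> d <= M ->
  (forall x x', - M <= x -> x <= x' -> x' <= M ->
     F x' - F x = (\int[mu]_(s in `[x, x']) viscous_slope fm fp u v s)%R) ->
  - M <= x <= M ->
  `|F x - F 0 - hfun fm fp w x| <=
  L * (\int[mu]_(s in `[- M, M]) `|u s - w s|)%R +
    M * (2 * d + e ^+ 2 / d ^+ 2 * (2 * M)).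
Proof.
move=> d0 dM dF /andP[Mx xM]; rewrite -Rintegral_gap//.
have iv : segment_integrable (viscous_slope fm fp u v).
  apply: continuous_segment_integrable.
  exact: (viscous_slope_continuous fm_C2 fp_C2 M0 sol).
have iw := double_waved_slope_integrable cfm cfp dw.
have ig := gap_integrable d.
have gap0 s : 0 <= gap d s.
  apply: addr_ge0; first exact: mulr_ge0.
  apply: mulr_ge0 (ltW M0) _; apply: addr_ge0; first by rewrite indicE.
  by apply: divr_ge0; exact: sqr_ge0.
have diff y z : - M <= y -> y <= z -> z <= M ->
    `|(F z - F y) - (hfun fm fp w z - hfun fm fp w y)| <=
    (\int[mu]_(s in `[- M, M]) gap d s)%R.
  move=> My yz zM; rewrite dF// /hfun (oriented_integralB iw yz).
  rewrite -(RintegralB _ (iv y z) (iw y z))//.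
  apply: le_trans (Rintegral_itv_mono ig gap0 My yz zM).
  apply: (normr_Rintegral_le (segment_integrableB iv iw) ig) => s /andP[ys sz].
  by apply: slope_gap => //; rewrite (le_lt_trans My)//= (lt_le_trans sz).
have h00 : hfun fm fp w 0 = 0 by exact: oriented_integral00.
have [x0|x0] := leP 0 x.
  have := diff 0 x; rewrite h00 subr0; apply=> //.
  by rewrite oppr_le0 ltW.
have := diff x 0 Mx (ltW x0) (ltW M0); rewrite h00 sub0r opprK.
by rewrite -normrN; congr (`|_| <= _); ring.
Qed.

(** The limit equals [b] on both sides of [0].  If the monotone profile misses
    [b] at [0], it misses it by at least as much on a whole side. *)
Lemma interface_value_gap l : 0 <= l ->
  l <= - fastest_speed fm uL b -> l <= slowest_speed fp b uR ->
  `|u 0 - b| * l <= (\int[mu]_(s in `[- M, M]) `|u s - w s|)%R.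
Proof.
move=> l0 lm lp.
have [sm0 _ wm _] := double_waved_left cfm dw.
have [sp0 _ wp _] := double_waved_right cfp dw.
have smM := left_edge_ge cfm cfp dw; have spM := right_edge_le cfm cfp dw.
rewrite -/M in smM spM.
have ig := dafermos_gap_integrable.
have one_side y : - M <= y -> y + l <= M ->
    (forall s, y < s < y + l -> `|u 0 - b| <= `|u s - w s|) ->
    `|u 0 - b| * l <= (\int[mu]_(s in `[- M, M]) `|u s - w s|)%R.
  move=> My ylM bnd.
  have yl : y <= y + l by rewrite lerDl.
  apply: le_trans (Rintegral_itv_mono ig _ My yl ylM); last by [].
  rewrite [X in _ * X](_ : l = y + l - y); last by ring.
  rewrite -Rintegral_itv_cst//; apply: le_Rintegral_itv ig _ => //.
  by apply: continuous_segment_integrable; exact: cst_continuous.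
have LR : 0 < `|uR - uL|.
  by rewrite normr_gt0 subr_eq0 eq_sym; exact: double_waved_neq dw.
have sgn_le (p q : R) : 0 <= (uR - uL) * p -> 0 <= (uR - uL) * q -> `|p| <= `|p + q|.
  move=> p0 q0; rewrite -(ler_pM2l LR) -!normrM mulrDr.
  by rewrite (ger0_norm p0) (ger0_norm (addr_ge0 p0 q0)) lerDl.
have [ub|ub] := leP 0 ((uR - uL) * (b - u 0)).
  apply: (one_side (- l)); rewrite ?addNr ?(ltW M0)//; first by lra.
  move=> s /andP[ls s0]; rewrite wm; last by rewrite s0 andbT; lra.
  rewrite distrC (distrC (u s)) (_ : b - u s = (b - u 0) + (u 0 - u s)); last by ring.
  by apply: sgn_le => //; apply: dafermos_monotone; rewrite ?ltW//; lra.
apply: (one_side 0); rewrite ?add0r ?oppr_le0 ?(ltW M0)//; first by lra.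
move=> s /andP[s0 sl]; rewrite wp; last by rewrite s0/=; lra.
rewrite (_ : u s - b = (u 0 - b) + (u s - u 0)); last by ring.
apply: sgn_le => //; first by rewrite -(opprB b) mulrN oppr_ge0 ltW.
by apply: dafermos_monotone; rewrite ?ltW//; lra.
Qed.

End OneViscosity.
End Distance.
End Approximation.

(** * The selection criterion in the vanishing viscosity limit *)

Section VanishingViscosity.
Context {R : realType}.
Local Notation mu := (@lebesgue_measure R).
Implicit Types (c d e x tau : R) (y : R -> R).

Lemma expRN_le_inv e eta : 0 < e -> 0 < eta -> expR (- eta / e) <= e / eta :> R.
Proof.
move=> e0 eta0; rewrite mulNr expRN -[e / eta]invf_div lef_pV2 ?posrE ?expR_gt0 ?divr_gt0//.
by apply: le_trans (expR_ge1Dx _); rewrite lerDr.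
Qed.

(** [P] and [Q] stand for the increments on the side that should be negligible
    and on the dominant side.  The bound [exp (- x) <= 1 / x] suffices to make
    the exponential small. *)
Lemma laplace_contradiction (P Q l W m eta e d : R) :
  0 < d -> 0 < l -> 0 < W -> 0 < m -> 0 < eta -> 0 < e ->
  d / 2 <= P -> 0 <= Q <= W -> P * l <= Q * m * expR (- eta / e) ->
  e < d * l * eta / (4 * W * m) -> False.
Proof.
move=> d0 l0 W0 m0 eta0 e0 dP /andP[Q0 QW] bal.
rewrite ltr_pdivlMr ?mulr_gt0// => small.
have h1 : d / 2 * l <= P * l by rewrite ler_pM2r.
have h2 : Q * m * expR (- eta / e) <= W * m * (e / eta).
  by apply: ler_pM; rewrite ?expR_ge0 ?mulr_ge0 ?(ltW m0)// ?ler_pM2r// expRN_le_inv.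
have h3 : d / 2 * l * eta <= W * m * e.
  rewrite -ler_pdivlMr// -[W * m * e / eta]mulrA.
  exact: le_trans h1 (le_trans bal h2).
have h4 : 0 < d * l * eta by rewrite !mulr_gt0.
have : d / 2 * l * eta = 2^-1 * (d * l * eta) by ring.
by move: small; rewrite (_ : e * (4 * W * m) = 4 * (W * m * e)); [lra|ring].
Qed.

(** Once the interface value [t] is close to the strictly intermediate state
    [b], both increments are bounded above and away from zero. *)
Lemma gaps_near_middle_state (uL uR b t : R) (d := Num.min `|b - uL| `|uR - b|) :
  uL < b < uR \/ uR < b < uL -> `|t - b| <= d / 2 ->
  [/\ 0 < d, 0 < 2 * `|uR - uL|,
      d / 2 <= `|uR - t| <= 2 * `|uR - uL|
    & d / 2 <= `|t - uL| <= 2 * `|uR - uL|].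
Proof.
move=> between tb.
have /andP[dL dR] : (d <= `|b - uL|) && (d <= `|uR - b|).
  by rewrite !ge_min !lexx orbT.
have [bL0 bR0 eqLR] : [/\ 0 < `|b - uL|, 0 < `|uR - b| &
    `|uR - uL| = `|uR - b| + `|b - uL|].
  case: between => /andP[h1 h2]; have h3 := lt_trans h1 h2.
    by rewrite !gtr0_norm ?subr_gt0//; split=> //; ring.
  by rewrite !ltr0_norm ?subr_lt0// !oppr_gt0 !subr_lt0; split=> //; ring.
have d0 : 0 < d by rewrite lt_min bL0.
have h1 := ler_normD (uR - t) (t - b); have h2 := ler_normD (b - t) (t - uL).
have h3 := ler_normD (uR - b) (b - t); have h4 := ler_normD (t - b) (b - uL).
move: h1 h2 h3 h4; rewrite !addrA !subrK !(distrC b t) eqLR => h1 h2 h3 h4.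
by split=> //; [lra|apply/andP; split; lra|apply/andP; split; lra].
Qed.

(** A gap of [4 * eta] between two levels of [h] leaves a gap of [eta] for the
    energy: one [eta] is lost because [h] is only near its minimum on
    [[x, x']], and one on each side because [F] is only near [h]. *)
Lemma unbalanced_wells a b e c (F h y : R -> R) A B C D x x' K eta :
  0 < e -> exponential_profile a b e F c y ->
  (forall z, a <= z <= b -> `|F z - F 0 - h z| <= eta) ->
  a <= A -> A <= x -> x < x' -> x' <= B -> B <= b ->
  a <= C -> C < D -> D <= b ->
  (forall z, x < z < x' -> h z <= K + eta) ->
  (forall z, C < z < D -> K + 4 * eta <= h z) ->
  `|y D - y C| * (x' - x) <= `|y B - y A| * (D - C) * expR (- eta / e).
Proof.
move=> e0 prof Fh aA Ax xx' x'B Bb aC CD Db hK Kh.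
apply: (exponential_profile_balance prof e0 aA Ax xx' x'B Bb aC CD Db
  (K := K + 2 * eta + F 0)) => z /andP[z1 z2].
  have : `|F z - F 0 - h z| <= eta.
    apply: Fh; apply/andP; split.
      exact: le_trans aA (le_trans Ax (ltW z1)).
    exact: le_trans (ltW z2) (le_trans x'B Bb).
  have := hK z; rewrite z1 z2 => /(_ isT) {hK} hK.
  by rewrite ler_norml => /andP[_]; move: hK => {Kh}; lra.
have : `|F z - F 0 - h z| <= eta.
  apply: Fh; apply/andP; split.
    exact: le_trans aC (ltW z1).
  exact: le_trans (ltW z2) Db.
have := Kh z; rewrite z1 z2 => /(_ isT) {Kh} Kh.
by rewrite ler_norml => /andP[+ _]; move: Kh; lra.
Qed.

Variables (fm fp : R -> R) (uL uR b : R) (w : R -> R).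
Let M := max_speed fm fp uL uR.
Hypotheses (fm_C2 : twice_cont_diff fm) (fp_C2 : twice_cont_diff fp).
Hypotheses (cfm : convex_flux fm) (cfp : convex_flux fp).
Hypothesis crd : CRD_solution fm fp uL uR w.
Hypothesis dw : double_waved fm fp uL uR b w.

Let M0 : 0 < M.
Proof. exact: max_speed_gt0 (double_waved_neq dw). Qed.

(** All the information that the limit process provides about the profiles:
    a single profile, as close to the limit as wanted, is enough to contradict
    a difference of the two minima. *)
Lemma vanishing_viscosity tau : 0 < tau -> exists e F c y,
  [/\ 0 < e < tau, exponential_profile (- M) M e F c y,
      y (- M) = uL /\ y M = uR,
      `|y 0 - b| < tau
    & forall x, - M <= x <= M -> `|F x - F 0 - hfun fm fp w x| <= tau].
Proof.
move=> tau0.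
have [sm0 _ _ _] := double_waved_left cfm dw.
have [sp0 _ _ _] := double_waved_right cfp dw.
set sm := fastest_speed fm uL b in sm0; set sp := slowest_speed fp b uR in sp0.
have [L L0 Llip] := flux_lipschitz uL uR fm_C2 fp_C2.
(* The three choices make each of the three terms of [primitive_gap] at most
   [tau / 4]; [tau * l] serves for the value at the interface. *)
pose d := Num.min M (tau / (8 * M)).
have d0 : 0 < d by rewrite lt_min M0 divr_gt0// mulr_gt0.
have dM : d <= M by rewrite ge_min lexx.
have dtau : M * (2 * d) <= tau / 4.
  have : d <= tau / (8 * M) by rewrite ge_min lexx orbT.
  by rewrite ler_pdivlMr ?mulr_gt0//; lra.
pose l := Num.min (- sm) sp.
have l0 : 0 < l by rewrite lt_min oppr_gt0 sm0.
pose E := Num.min 1 (Num.min tau (tau * d ^+ 2 / (8 * M ^+ 2))).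
have E0 : 0 < E.
  by rewrite !lt_min ltr01 tau0 divr_gt0// ?mulr_gt0// exprn_gt0.
pose I0 := Num.min (tau / (4 * (L + 1))) (tau * l).
have L1 : 0 < L + 1 by rewrite ltr_wpDl.
have I00 : 0 < I0 by rewrite lt_min !divr_gt0 ?mulr_gt0.
case: crd => _ _ [eps [un [vn [eps0 epscvg sol L1cvg]]]].
have fcvg : (fun n => \int[mu]_(x in `[- M, M]) `|un n x - w x|)%R @ \oo --> (0 : R).
  exact: (fine_cvg (L1cvg _ (@segment_compact _ (- M) M))).
have [n [en In]] : exists n, eps n < E /\
    (\int[mu]_(x in `[- M, M]) `|un n x - w x|)%R < I0.
  near \oo => n; exists n; split.
    by near: n; exact: (cvgr_lt _ epscvg).
  by near: n; exact: (cvgr_lt _ fcvg).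
have [F [c [prof dF]]] := dafermos_exponential_profile fm_C2 fp_C2 M0 (eps0 n) (sol n).
have [uLe uRe _ _] := dafermos_ends (sol n).
move: en; rewrite !lt_min => /and3P[e1 etau esmall].
move: In; rewrite lt_min => /andP[IL Il].
exists (eps n), F, c, (un n); split=> //.
- by rewrite eps0.
- have := interface_value_gap fm_C2 fp_C2 cfm cfp dw (eps0 n) (sol n) (ltW l0).
  rewrite !ge_min !lexx orbT => /(_ isT isT) /le_lt_trans/(_ Il).
  by rewrite ltr_pM2r.
- move=> x xI.
  have := primitive_gap fm_C2 fp_C2 cfm cfp dw L0 Llip (eps0 n) (sol n) d0 dM dF xI.
  move/le_trans; apply.
  set I := Rintegral _ _ _ in IL *.
  have h1 : L * I <= tau / 4.
    have I_ge0 : 0 <= I by exact: Rintegral_ge0.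
    move: IL; rewrite ltr_pdivlMr ?mulr_gt0//.
    rewrite (_ : I * (4 * (L + 1)) = 4 * (L * I) + 4 * I); last by ring.
    by lra.
  have h2 : M * (eps n ^+ 2 / d ^+ 2 * (2 * M)) <= tau / 4.
    move: esmall; rewrite ltr_pdivlMr ?mulr_gt0 ?exprn_gt0// => esmall.
    rewrite (_ : _ * _ = (2 * M ^+ 2 * eps n ^+ 2) / d ^+ 2); last by ring.
    rewrite ler_pdivrMr ?exprn_gt0//.
    have : eps n ^+ 2 <= eps n.
      by rewrite expr2 -[leRHS]mulr1 ler_pM2l ?eps0// ltW.
    move=> /(ler_wpM2l (_ : 0 <= M ^+ 2)) => /(_ (sqr_ge0 _)).
    by lra.
  by rewrite -/M mulrDr; lra.
Unshelve. all: by end_near. Qed.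

Lemma CRD_selection : selection_criterion fm fp uL uR w.
Proof.
apply/(selection_criterionE cfm cfp dw).
set sm := fastest_speed fm uL b; set sp := slowest_speed fp b uR.
set h := hfun fm fp w.
have [sm0 _ _ _] := double_waved_left cfm dw; rewrite -/sm in sm0.
have [sp0 _ _ _] := double_waved_right cfp dw; rewrite -/sp in sp0.
have smM : - M <= sm := left_edge_ge cfm cfp dw.
have spM : sp <= M := right_edge_le cfm cfp dw.
apply/eqP; rewrite -[_ == _]negbK; apply/negP => neq.
(* A quarter of the gap between the minima, for [unbalanced_wells]. *)
have [eta etaE] : exists eta, eta = `|h sp - h sm| / 4 by eexists.
have eta0 : 0 < eta by rewrite etaE divr_gt0// normr_gt0 subr_eq0 eq_sym.
(* Within [l] of its minimizers, on the inner side, [h] exceeds its minima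
   by at most [eta]. *)
have [l [l0 lsm lsp lM]] : exists l, [/\ 0 < l, l <= - sm, l <= sp & l * M <= eta].
  exists (Num.min (Num.min (- sm) sp) (eta / M)).
  by rewrite !lt_min oppr_gt0 sm0 sp0 divr_gt0// -ler_pdivlMr// !ge_min !lexx !orbT.
have between : uL < b < uR \/ uR < b < uL by case: dw.
have [d dE] : exists d, d = Num.min `|b - uL| `|uR - b| by eexists.
have [W WE] : exists W, W = 2 * `|uR - uL| by eexists.
have [d0 W0] : 0 < d /\ 0 < W.
  rewrite dE WE; have [|? ? _ _] := gaps_near_middle_state (t := b) between => //.
  by rewrite subrr normr0 divr_ge0// le_min !normr_ge0.
have [tau [tau0 taueta taud taue]] : exists tau, [/\ 0 < tau, tau <= eta,
    tau <= d / 2 & tau <= d * l * eta / (4 * W * M)].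
  exists (Num.min (Num.min eta (d / 2)) (d * l * eta / (4 * W * M))).
  rewrite !lt_min eta0 divr_gt0//= divr_gt0 ?mulr_gt0//.
  by rewrite !ge_min !lexx !orbT.
have [e [F [c [y [/andP[e0 etau] prof [yL yR] y0b Fh]]]]] := vanishing_viscosity tau0.
have y0d := le_trans (ltW y0b) taud; rewrite dE in y0d.
have [_ _] := gaps_near_middle_state between y0d; rewrite -dE -WE => /andP[yRd yRW] /andP[yLd yLW].
have small := lt_le_trans etau taue.
have {}Fh z : - M <= z <= M -> `|F z - F 0 - h z| <= eta.
  by move=> /Fh/le_trans; apply.
have NM : - M < 0 by rewrite oppr_lt0.
move: neq; rewrite neq_lt => /orP[lt|lt].
- have hsp : h sp = h sm + 4 * eta by rewrite etaE gtr0_norm ?subr_gt0//; field.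
  have smx : sm < sm + l by rewrite ltrDl.
  have xB : sm + l <= 0 by rewrite -lerBrDl sub0r.
  have hJ z : sm < z < sm + l -> h z <= h sm + eta.
    move=> /andP[sz zl].
    have zI : sm <= z <= 0 by rewrite (ltW sz) (le_trans (ltW zl)).
    apply: le_trans (hfun_left_near_min cfm cfp dw zI) _; rewrite lerD2l.
    by apply: le_trans lM; rewrite ler_pM2r// lerBlDl ltW.
  have hC z : 0 < z < M -> h sm + 4 * eta <= h z.
    by move=> /andP[/ltW z0 _]; rewrite -hsp; exact: (hfun_right_min cfm cfp dw).
  have := unbalanced_wells e0 prof Fh (lexx _) smM smx xB (ltW M0) (ltW NM) M0 (lexx _) hJ hC.
  rewrite yL yR subr0 [sm + l]addrC addrK => bal.
  by apply: (laplace_contradiction d0 l0 W0 M0 eta0 e0 yRd _ bal small); rewrite normr_ge0.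
- have hsm : h sm = h sp + 4 * eta by rewrite etaE ltr0_norm ?subr_lt0//; field.
  have xsp : sp - l < sp by rewrite gtrBl.
  have Bx : 0 <= sp - l by rewrite subr_ge0.
  have hJ z : sp - l < z < sp -> h z <= h sp + eta.
    move=> /andP[lz zs].
    have zI : 0 <= z <= sp by rewrite (ltW zs) (le_trans _ (ltW lz)).
    apply: le_trans (hfun_right_near_min cfm cfp dw zI) _; rewrite lerD2l.
    by apply: le_trans lM; rewrite ler_pM2r// lerBlDl -lerBlDr ltW.
  have hC z : - M < z < 0 -> h sp + 4 * eta <= h z.
    by move=> /andP[_ /ltW z0]; rewrite -hsm; exact: (hfun_left_min cfm cfp dw).
  have := unbalanced_wells e0 prof Fh (ltW NM) Bx xsp spM (lexx _) (lexx _) NM (ltW M0) hJ hC.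
  rewrite yL yR sub0r opprK opprB addrCA subrr addr0 => bal.
  by apply: (laplace_contradiction d0 l0 W0 M0 eta0 e0 yLd _ bal small); rewrite normr_ge0.
Qed.

End VanishingViscosity.

Theorem proposition5p2 (R : realType) (fm fp : R -> R) (usm usp : \bar R)
    (uL uR ubar : R) (u : R -> R)
    (fm_C2 : twice_cont_diff fm) (fp_C2 : twice_cont_diff fp)
    (fm_convex : strictly_convex fm) (fp_convex : strictly_convex fp)
    (usm_sonic : is_sonic_point fm usm) (usp_sonic : is_sonic_point fp usp)
    (u_CRD : CRD_solution fm fp uL uR u)
    (u_double : double_waved fm fp uL uR ubar u) :
  [/\ (usp < ubar%:E < usm)%E,
      selection_criterion fm fp uL uR u
    & forall (b : R) (w : R -> R), (usp < b%:E < usm)%E ->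
        double_waved fm fp uL uR b w ->
        selection_criterion fm fp uL uR w -> b = ubar].
Proof.
have cfm : convex_flux fm by split=> //; case: fm_C2.
have cfp : convex_flux fp by split=> //; case: fp_C2.
have sel := CRD_selection fm_C2 fp_C2 cfm cfp u_CRD u_double.
split=> //; first exact: double_waved_sonic u_double.
move=> b w _ w_double w_sel; have [lt|lt|//] := ltgtP b ubar.
- by case: (double_waved_selection_lt cfm cfp lt w_double u_double w_sel sel).
- by case: (double_waved_selection_lt cfm cfp lt u_double w_double sel w_sel).
Qed.
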